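(* If $T_\psi$ is transitive then $h_{\mathrm{Gur}}(T_\psi) =h_{\mathrm{Gur}}(T_{\psi^{\mathrm{ab}}})$ if and only if $G$ is amenable.
   Context: Let $\sigma:\Sigma\to\Sigma$ be a mixing subshift of finite type, $G$ a countable group with identity $e$, and $\psi:\Sigma\to G$ a function (depending on finitely many, e.g. two, coordinates). The $G$-extension (skew product) is $T_\psi:\Sigma\times G\to\Sigma\times G$, $T_\psi(x,g)=(\sigma x, g\psi(x))$, and $\psi^n(x)=\psi(x)\psi(\sigma x)\cdots\psi(\sigma^{n-1}x)$. The Gurevič entropy is $h_{\mathrm{Gur}}(T_\psi) = \limsup_{n\to\infty}\frac1n\log\#\{x\in\Sigma : \sigma^n x = x,\ \psi^n(x)=e\}$. With $G^{\mathrm{ab}}=G/[G,G]$ the abelianization, $\pi:G\to G^{\mathrm{ab}}$ the projection and $\psi^{\mathrm{ab}}=\pi\circ\psi$, $T_{\psi^{\mathrm{ab}}}:\Sigma\times G^{\mathrm{ab}}\to\Sigma\times G^{\mathrm{ab}}$ is the induced $G^{\mathrm{ab}}$-extension (with $h_{\mathrm{Gur}}$ defined analogously, using the identity of $G^{\mathrm{ab}}$). *)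

(* Defs.v *)
From HB Require Import structures.
From mathcomp Require Import all_boot all_order all_algebra.
From mathcomp Require Import all_classical all_reals.
From mathcomp Require Import topology normedtype sequences exp.
From mathcomp Require Import Rstruct.
From Stdlib Require Import List ClassicalEpsilon.
From Stdlib Require Rdefinitions.
Notation R := Rdefinitions.R.

Set Implicit Arguments.
Unset Strict Implicit.
Unset Printing Implicit Defensive.
Import Order.TTheory GRing.Theory Num.Theory.

Local Open Scope ring_scope.

Record group := Group {
  gcar :> Type;
  gmul : gcar -> gcar -> gcar;
  ginv : gcar -> gcar;
  gone : gcar;
  gmulA : forall x y z, gmul x (gmul y z) = gmul (gmul x y) z;
  gmul1l : forall x, gmul gone x = x;
  gmul1r : forall x, gmul x gone = x;
  gmulVl : forall x, gmul (ginv x) x = gone;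
  gmulVr : forall x, gmul x (ginv x) = gone }.

Arguments gmul {g}.
Arguments ginv {g}.
Arguments gone {g}.

Definition countable_group (G : group) : Prop :=
  exists f : G -> nat, forall x y, f x = f y -> x = y.

Definition group_hom (G H : group) (f : G -> H) : Prop :=
  forall x y, f (gmul x y) = gmul (f x) (f y).

(** commutator [x,y] = x^-1 y^-1 x y, commutator subgroup [G,G] =
    the set of finite products of commutators (closed under inverses since
    [x,y]^-1 = [y,x]). *)
Definition commutator (G : group) (x y : G) : G :=
  gmul (gmul (ginv x) (ginv y)) (gmul x y).

Definition in_commutator_subgroup (G : group) (g : G) : Prop :=
  exists l : list (G * G),
    g = fold_right (fun p acc => gmul (commutator p.1 p.2) acc) gone l.

Definition is_abelianization (G Gab : group) (pi : G -> Gab) : Prop :=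
  [/\ group_hom pi,
      forall h : Gab, exists g : G, pi g = h &
      forall g : G, pi g = gone <-> in_commutator_subgroup g].

Definition bounded_fun (G : Type) (f : G -> R) : Prop :=
  exists c : R, forall x, `|f x| <= c.

Definition amenable (G : group) : Prop :=
  exists m : (G -> R) -> R,
    [/\ forall f h, bounded_fun f -> bounded_fun h ->
          m (fun x => f x + h x) = m f + m h,
        forall (c : R) f, bounded_fun f -> m (fun x => c * f x) = c * m f,
        forall f, bounded_fun f -> (forall x, 0 <= f x) -> 0 <= m f,
        m (fun _ => 1) = 1 &
        forall (g : G) f, bounded_fun f -> m (fun x => f (gmul g x)) = m f].

Definition inSFT (A : finType) (M : rel A) (x : nat -> A) : Prop :=
  forall i, M (x i) (x i.+1).

Definition shift (A : Type) (x : nat -> A) : nat -> A := fun i => x i.+1.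

Definition shiftn (A : Type) (n : nat) (x : nat -> A) : nat -> A :=
  fun i => x (n + i)%N.

Definition mixing_rel (A : finType) (M : rel A) : Prop :=
  exists N : nat, forall n : nat, (N <= n)%N -> forall a b : A,
    exists w : nat -> A, [/\ w 0%N = a, w n = b &
                            forall i, (i < n)%N -> M (w i) (w i.+1)].

Definition locally_constant (A : finType) (M : rel A) (G : Type)
    (psi : (nat -> A) -> G) : Prop :=
  exists m : nat, forall x y, inSFT M x -> inSFT M y ->
    (forall i, (i < m)%N -> x i = y i) -> psi x = psi y.

Fixpoint cocycle (A : Type) (G : group) (psi : (nat -> A) -> G) (n : nat)
    (x : nat -> A) : G :=
  match n with
  | 0 => gone
  | n'.+1 => gmul (psi x) (cocycle psi n' (shift x))
  end.

(** skew product T_psi(x,g) = (sigma x, g psi(x)); its n-th iterate *)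
Definition skew_iter (A : Type) (G : group) (psi : (nat -> A) -> G) (n : nat)
    (p : (nat -> A) * G) : (nat -> A) * G :=
  (shiftn n p.1, gmul p.2 (cocycle psi n p.1)).

(** open subsets of Sigma x G (product of the cylinder topology on Sigma and
    the discrete topology on G) *)
Definition open_skew (A : finType) (M : rel A) (G : Type)
    (U : (nat -> A) * G -> Prop) : Prop :=
  (forall p, U p -> inSFT M p.1) /\
  forall p, U p -> exists m : nat, forall y, inSFT M y ->
    (forall i, (i < m)%N -> y i = p.1 i) -> U (y, p.2).

Definition skew_transitive (A : finType) (M : rel A) (G : group)
    (psi : (nat -> A) -> G) : Prop :=
  forall U V : (nat -> A) * G -> Prop,
    open_skew M U -> open_skew M V -> (exists p, U p) -> (exists p, V p) ->
    exists n : nat, (0 < n)%N /\ exists p, V p /\ U (skew_iter psi n p).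

(** cardinality of a finite set given by a predicate (via a duplicate-free
    enumeration); arbitrary if the set is infinite *)
Definition is_card (T : Type) (P : T -> Prop) (N : nat) : Prop :=
  exists l : list T, NoDup l /\ (forall x, In x l <-> P x) /\ length l = N.

Definition card_of (T : Type) (P : T -> Prop) : nat :=
  epsilon (inhabits 0%N) (fun N => is_card P N).

Definition nper (A : finType) (M : rel A) (G : group) (psi : (nat -> A) -> G)
    (n : nat) : nat :=
  card_of (fun x : nat -> A =>
             inSFT M x /\ shiftn n x = x /\ cocycle psi n x = gone).

Definition h_Gur (A : finType) (M : rel A) (G : group) (psi : (nat -> A) -> G)
    : \bar R :=
  limn_esup (fun n : nat =>
    if nper M psi n == 0%N then -oo%E
    else ((ln (nper M psi n)%:R) / n%:R)%:E).

(* Main.v *)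
(** Recode the subshift as a finite graph [V] with labels in [G], and let [P] be the
    adjacency operator of the covering graph on [V * G]. The exponential growth
    rate of the return weights of [P] is [exp h_Gur], for [G] and likewise for
    [Gab].

    If [G] is amenable and [lam > exp h_Gur], a positive function [f] with
    [P f <= lam f] exists (a Green function). The mean over [h] of
    [log (f (a, h g) / f (o, h))] is, by Jensen, again the logarithm of a
    superharmonic function, now of the form [chi g * F a] with a character [chi].
    Such a function lives on the [Gab]-cover and bounds the growth there by [lam].

    Conversely, [Gab] is amenable, so the above gives [chi] and [F] for every [lam]
    above the growth rate of the [Gab]-cover. The Doob transform by [chi g * F a] is
    a sub-Markov walk on the [G]-cover that contracts a weighted [l^2] space. When
    both growth rates agree its spectral radius is close to [1], which forces
    functions of finite support with small energy, hence almost invariant vectors in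
    [l^2 G]; their squares give an invariant mean in the limit. *)

From mathcomp Require Import all_boot all_order all_algebra.
From mathcomp Require Import all_classical all_reals.
From mathcomp Require Import ereal topology normedtype sequences exp.
From mathcomp Require Import Rstruct.
From mathcomp Require Import ring lra zify.
Require Import Defs.

Set Implicit Arguments.
Unset Strict Implicit.
Unset Printing Implicit Defensive.
Import Order.TTheory GRing.Theory Num.Theory.
Import numFieldNormedType.Exports.

Local Open Scope classical_set_scope.
Local Open Scope ring_scope.

(** The walk is not reversible, so a large return weight says nothing directly about a quadratic
    form. The proof goes through the lazy operator 1 + P, with P the Doob transform: the cross terms
    cancel in [(x + y)^2 + (y - x)^2], so the energy bounds from below what the squared norm loses
    against the factor 4, without any symmetry of P. Return weights come back through the
    coefficient C(2k,k) of P^k in (1 + P)^(2k), at the cost of the factor 2k+1 seen in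
    [exists_low_energy] and [amenable_of_growth]. The weight of the l^2 space is a product of a left
    and a right superharmonic vector, since both row and column sums of the walk have to be
    controlled. Superharmonic functions are built strictly above the critical rate, where the Green
    series converge. As [lam] approaches the rate, [chi], [F] and [pi] change without control, so
    every comparison constant has to come from the graph alone; this is the role of
    [uniform_harnack]. *)

(** * Analytic tools: resolvent series and limits along ultrafilters *)

(** The witness is the resolvent series of [u n x / lam ^+ n]: each term is below the sum, and
    applying the operator shifts the index and drops the term at 0. The abstract [k] and [s] let it
    serve both the covering graph and a transposed matrix on [V]. *)
Lemma superharmonic_of_orbit (F : realType) (X : Type) (I : finType)
    (k : X -> I -> F) (s : X -> I -> X) (u : nat -> X -> F) (mu lam : F) :
  0 < mu -> mu < lam -> (forall x i, 0 <= k x i) -> (forall n x, 0 <= u n x) ->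
  (forall n x, u n.+1 x = \sum_i k x i * u n (s x i)) ->
  (forall x, exists C, forall n, u n x <= C * mu ^+ n) ->
  exists f : X -> F, (forall n x, u n x <= lam ^+ n * f x) /\
    (forall x, \sum_i k x i * f (s x i) <= lam * f x).
Proof.
move=> mu0 mulam k0 u0 uS ub.
have lam0 : 0 < lam by exact: lt_trans mulam.
pose t (x : X) : F^nat := fun n => u n x / lam ^+ n.
have t0 x n : 0 <= t x n by rewrite divr_ge0 ?u0 ?exprn_ge0 ?ltW.
have tcv x : cvgn (series (t x)).
  have [C uC] := ub x.
  apply: (@series_le_cvg _ (t x) (geometric C (mu / lam))) => //.
  - move=> n; rewrite /geometric /= mulr_ge0 ?exprn_ge0 ?divr_ge0 ?(ltW mu0) ?(ltW lam0) //.
    by have := uC 0%N; rewrite expr0 mulr1; exact: le_trans.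
  - move=> n; rewrite /geometric /= /t expr_div_n mulrA.
    by rewrite ler_pM2r ?invr_gt0 ?exprn_gt0.
  - apply: is_cvg_geometric_series.
    by rewrite ger0_norm ?divr_ge0 ?ltW // ltr_pdivrMr // mul1r.
pose f x := limn (series (t x)).
have sle x n : series (t x) n <= f x.
  apply: nondecreasing_cvgn_le; last exact: tcv.
  apply: nondecreasing_series => i _ _; exact: t0.
exists f; split=> [n x|x].
  rewrite mulrC -ler_pdivrMr ?exprn_gt0 //; apply: le_trans (sle x n.+1).
  rewrite seriesSr lerDr seriesEnat /=; apply: sumr_ge0 => i _; exact: t0.
have cvT : (fun n => \sum_i k x i * series (t (s x i)) n) @ \oo -->
    \sum_i k x i * f (s x i).
  apply: cvg_big => [|i _]; first exact: add_continuous.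
  by apply: cvgMl_tmp; exact: tcv.
have bd n : \sum_i k x i * series (t (s x i)) n <= lam * f x.
  apply: (@le_trans _ _ (lam * series (t x) n.+1)); last first.
    by rewrite ler_pM2l.
  rewrite !seriesEnat /= big_nat_recl //= mulrDr.
  apply: ler_wpDl; first by rewrite mulr_ge0 ?t0 ?(ltW lam0).
  rewrite mulr_sumr.
  rewrite (eq_bigr (fun i => \sum_(0 <= j < n) k x i * t (s x i) j)); last first.
    by move=> i _; rewrite mulr_sumr.
  rewrite exchange_big /=; apply: ler_sum => j _.
  rewrite /t uS exprS invfM mulrCA mulVKf ?gt_eqF // mulr_suml.
  by apply: ler_sum => i _; rewrite mulrA.
rewrite -(cvg_lim _ cvT) //; apply: limr_le.
  by apply: cvgP cvT.
by near=> n; exact: bd.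
Unshelve. all: by end_near. Qed.

Lemma fmap_ultrafilter (T T' : Type) (f : T -> T') (U : set_system T) :
  UltraFilter U -> UltraFilter (f @ U).
Proof.
move=> UU; split; first exact: fmap_proper_filter.
move=> H HP UH; apply/seteqP; split=> // B HB.
have [//|UnB] := in_ultra_setVsetC (f @^-1` B) UU.
have HnB : H (~` B) by exact: UH.
have : H set0 by rewrite -(setICr B); exact: filterI.
by move/filter_not_empty.
Qed.

(** The limit along an ultrafilter refining [\oo]: a bounded sequence stays in a compact segment,
    where ultrafilters converge. The last clause is what turns asymptotic invariance into
    invariance. *)
Lemma generalized_limit (F : realType) :
  let bounded (u : nat -> F) := exists C : F, forall n, `|u n| <= C in
  exists L : (nat -> F) -> F,
  [/\ forall u v, bounded u -> bounded v -> L (fun n => u n + v n) = L u + L v,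
      forall c u, bounded u -> L (fun n => c * u n) = c * L u,
      forall u, bounded u -> (forall n, 0 <= u n) -> 0 <= L u,
      L (fun=> 1) = 1 &
      forall u : nat -> F,
        (forall e : F, 0 < e -> exists N, forall n, (N <= n)%N -> `|u n| <= e) ->
        L u = 0].
Proof.
move=> bounded; have [U [UU ooU]] := @ultraFilterLemma nat \oo _.
have UP : ProperFilter U by exact: ultra_proper.
pose L (u : nat -> F) : F := lim (u @ U).
have cvb u : bounded u -> u @ U --> L u.
  move=> [C uC].
  have := @segment_compact F (- C) C; rewrite compact_ultra /= => /(_ (u @ U)).
  case=> [||p [_ up]].
  - exact: fmap_ultrafilter.
  - rewrite /fmap /=; apply: filterE => n /=; rewrite in_itv /= -ler_norml; exact: uC.
  - exact: cvgP up.
exists L; split=> [u v bu bv|c u bu|u bu u0||u u0].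
- by apply: cvg_lim => //; apply: cvgD; exact: cvb.
- by apply: cvg_lim => //; apply: cvgMl_tmp; exact: cvb.
- apply: limr_ge; first by apply: cvgP (cvb _ bu).
  exact: filterE.
- by apply: cvg_lim => //; exact: cvg_cst.
- apply: cvg_lim => //; apply/cvgrPdist_le => e e0.
  have [N uN] := u0 _ e0; apply: ooU; exists N => // n /= Nn.
  by rewrite sub0r normrN uN.
Qed.

(** * Means on groups; amenability of countable abelian groups *)

Lemma gmul_injr (G : group) (k : G) : injective (gmul^~ k).
Proof. by move=> x y /(congr1 (gmul^~ (ginv k))); rewrite -!gmulA gmulVr !gmul1r. Qed.

Lemma ginv_mulVl (G : group) (g x : G) :
  ginv (gmul (ginv g) x) = gmul (ginv x) g.
Proof.
apply: (@gmul_injr _ (gmul (ginv g) x)); rewrite /= gmulVl -gmulA.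
by rewrite (gmulA g) gmulVr gmul1l gmulVl.
Qed.

Lemma ginvK (G : group) (x : G) : ginv (ginv x) = x.
Proof. by apply: (@gmul_injr _ (ginv x)); rewrite /= gmulVl gmulVr. Qed.

Definition is_mean (X : Type) (m : (X -> R) -> R) : Prop :=
  [/\ forall f h, bounded_fun f -> bounded_fun h ->
        m (fun x => f x + h x) = m f + m h,
      forall (c : R) f, bounded_fun f -> m (fun x => c * f x) = c * m f,
      forall f, bounded_fun f -> (forall x, 0 <= f x) -> 0 <= m f &
      m (fun _ => 1) = 1].

Lemma bounded_funD (X : Type) (f h : X -> R) : bounded_fun f -> bounded_fun h ->
  bounded_fun (fun x => f x + h x).
Proof.
move=> [C fC] [D hD]; exists (C + D) => x.
by apply: le_trans (ler_normD _ _) _; apply: lerD.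
Qed.

Lemma bounded_funZ (X : Type) (c : R) (f : X -> R) : bounded_fun f ->
  bounded_fun (fun x => c * f x).
Proof. by move=> [C fC]; exists (`|c| * C) => x; rewrite normrM ler_wpM2l. Qed.

Lemma bounded_fun_cst (X : Type) (c : R) : bounded_fun (fun _ : X => c).
Proof. by exists `|c|. Qed.

Lemma bounded_fun_comp (X Y : Type) (g : X -> Y) (f : Y -> R) : bounded_fun f ->
  bounded_fun (fun x => f (g x)).
Proof. by move=> [C fC]; exists C. Qed.

Lemma mean_cst (X : Type) (m : (X -> R) -> R) (c : R) : is_mean m ->
  m (fun=> c) = c.
Proof.
case=> _ mZ _ m1; have := mZ c _ (bounded_fun_cst X 1).
by rewrite m1 !mulr1.
Qed.

Lemma mean_le (X : Type) (m : (X -> R) -> R) (f h : X -> R) : is_mean m ->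
  bounded_fun f -> bounded_fun h -> (forall x, f x <= h x) -> m f <= m h.
Proof.
move=> [mD mZ m0 m1] bf bh fh; rewrite -subr_ge0.
have -> : m h - m f = m (fun x => h x + (-1) * f x).
  by rewrite mD // ?mZ ?mulN1r //; exact: bounded_funZ.
apply: m0 => [|x]; last by rewrite mulN1r subr_ge0.
by apply: bounded_funD => //; exact: bounded_funZ.
Qed.

Lemma mean_norm_le (X : Type) (m : (X -> R) -> R) (f : X -> R) (C : R) :
  is_mean m -> (forall x, `|f x| <= C) -> `|m f| <= C.
Proof.
move=> mm fC; have bf : bounded_fun f by exists C.
rewrite ler_norml -[C in _ && (_ <= C)](mean_cst C mm).
rewrite -[- C](mean_cst (- C) mm) !(mean_le mm) //; try exact: bounded_fun_cst.
  by move=> x; have := fC x; rewrite ler_norml => /andP[].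
by move=> x; have := fC x; rewrite ler_norml => /andP[].
Qed.

Lemma mean_sum (X : Type) (m : (X -> R) -> R) (I : Type) (r : seq I)
    (P : pred I) (f : I -> X -> R) : is_mean m -> (forall i, bounded_fun (f i)) ->
  bounded_fun (fun x => \sum_(i <- r | P i) f i x) /\
  m (fun x => \sum_(i <- r | P i) f i x) = \sum_(i <- r | P i) m (f i).
Proof.
move=> mm bf; elim: r => [|i r [IHb IH]].
  have -> : (fun x => \sum_(i <- [::] | P i) f i x) = fun=> 0.
    by apply/funext => x; rewrite big_nil.
  by rewrite big_nil (mean_cst _ mm); split=> //; exact: bounded_fun_cst.
rewrite big_cons.
have -> : (fun x => \sum_(j <- i :: r | P j) f j x) =
    fun x => (if P i then f i x else 0) + \sum_(j <- r | P j) f j x.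
  by apply/funext => x; rewrite big_cons; case: ifP; rewrite ?add0r.
case: (P i).
  by split; [exact: bounded_funD | case: mm => -> // _ _ _; rewrite IH].
under eq_fun do rewrite add0r.
by [].
Qed.

(* Jensen's inequality: [expR] lies above its tangent at the mean value. *)
Lemma expR_mean_le (X : Type) (m : (X -> R) -> R) (f : X -> R) : is_mean m ->
  bounded_fun f -> bounded_fun (fun x => expR (f x)) ->
  expR (m f) <= m (fun x => expR (f x)).
Proof.
move=> mm bf be; set c := m f.
have -> : expR c = m (fun x => expR c * (1 + (f x + - c))).
  have bfc : bounded_fun (fun x => f x + - c).
    by apply: bounded_funD => //; exact: bounded_fun_cst.
  have [mD mZ _ m1] := mm; rewrite mZ ?mD ?m1 //; try exact: bounded_fun_cst.
    by rewrite (mean_cst _ mm) subrr addr0 mulr1.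
  by apply: bounded_funD => //; exact: bounded_fun_cst.
apply: mean_le => // [|x].
  apply: bounded_funZ; do 2?apply: bounded_funD => //; exact: bounded_fun_cst.
apply: (@le_trans _ _ (expR c * expR (f x - c))).
  by rewrite ler_pM2l ?expR_gt0 // expR_ge1Dx.
by rewrite -exp.expRD addrC subrK.
Qed.

(** Labels multiply on the right, so the graph arguments consume and produce right-invariant means;
    inversion exchanges the two sides. *)
Lemma amenable_right_mean (G : group) : amenable G <->
  exists m : (G -> R) -> R, is_mean m /\
    forall (g : G) f, bounded_fun f -> m (fun x => f (gmul x g)) = m f.
Proof.
have flip (m : (G -> R) -> R) : is_mean m -> is_mean (fun f => m (fun x => f (ginv x))).
  case=> mD mZ m0 m1; split=> // [f h bf bh|c f bf|f bf f0].
  - by rewrite -mD //; exact: bounded_fun_comp.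
  - by rewrite -mZ //; exact: bounded_fun_comp.
  - by apply: m0 => //; exact: bounded_fun_comp.
split=> [[m [mD mZ m0 m1 mg]]|[m [mm mg]]].
  exists (fun f => m (fun x => f (ginv x))); split; first exact: flip.
  move=> g f bf; rewrite -(mg (ginv g) (fun x => f (ginv x))).
    by congr m; apply/funext => x; rewrite ginv_mulVl.
  exact: bounded_fun_comp.
exists (fun f => m (fun x => f (ginv x))).
have [mD mZ m0 m1] := flip _ mm; split => // g f bf.
rewrite -(mg (ginv g) (fun x => f (ginv x))); last exact: bounded_fun_comp.
congr m; apply/funext => x; congr f.
by rewrite -{2}(ginvK x) ginv_mulVl ginvK.
Qed.

(** A generalized limit of the means is exactly invariant, even though the threshold [N] may depend
    on [g], [f] and [e]. *)
Lemma amenable_of_approx (G : group) (m : nat -> (G -> R) -> R) :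
  (forall n, is_mean (m n)) ->
  (forall (g : G) f, bounded_fun f -> forall e : R, 0 < e -> exists N,
     forall n, (N <= n)%N -> `|m n (fun x => f (gmul x g)) - m n f| <= e) ->
  amenable G.
Proof.
move=> mm mg; apply/amenable_right_mean.
have [L [LD LZ L0 L1 Lz]] := generalized_limit R.
have bm f : bounded_fun f -> exists C, forall n, `|m n f| <= C.
  by move=> [C fC]; exists C => n; exact: mean_norm_le.
exists (fun f => L (fun n => m n f)); split.
  split=> [f h bf bh|c f bf|f bf f0|].
  - rewrite -LD; try exact: bm.
    congr L; apply/funext => n; have [mD _ _ _] := mm n. exact: mD.
  - rewrite -LZ; last exact: bm.
    by congr L; apply/funext => n; have [_ mZ _ _] := mm n; exact: mZ.
  - by apply: L0; [exact: bm | move=> n; have [_ _ m0 _] := mm n; exact: m0].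
  - by rewrite -[RHS]L1; congr L; apply/funext => n; case: (mm n).
move=> g f bf; have bfg : bounded_fun (fun x => f (gmul x g)) by exact: bounded_fun_comp.
apply/eqP; rewrite -subr_eq0; apply/eqP.
rewrite -[RHS](Lz _ (mg g f bf)).
transitivity (L (fun n => m n (fun x => f (gmul x g)) + (-1) * m n f)).
  rewrite LD ?LZ ?mulN1r //; try exact: bm.
  by have [C mC] := bm _ bf; exists C => n; rewrite mulN1r normrN.
by congr L; apply/funext => n; rewrite mulN1r.
Qed.

Fixpoint gpow (G : group) (g : G) (n : nat) : G :=
  if n is n'.+1 then gmul g (gpow g n') else gone.

Definition orbit_avg (G : group) (n : nat) (g : G) (f : G -> R) : G -> R :=
  fun x => n.+1%:R^-1 * \sum_(j < n.+1) f (gmul x (gpow g j)).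

Lemma mean_orbit_avg (G : group) (n : nat) (g x : G) :
  is_mean (fun f => orbit_avg n g f x).
Proof.
have n0 : 0 <= n.+1%:R^-1 :> R by rewrite invr_ge0.
split=> [f h _ _|c f _|f _ f0|].
- by rewrite /orbit_avg big_split mulrDr.
- by rewrite /orbit_avg -mulr_sumr mulrCA.
- by rewrite mulr_ge0 // sumr_ge0.
- by rewrite /orbit_avg sumr_const card_ord mulVf // pnatr_eq0.
Qed.

(** In an abelian group, the average over the box of products of powers of the first [k] elements,
    with exponents at most [n]: a Folner box. Nesting averages avoids discussing products that
    coincide. *)
Definition multi_avg (G : group) (e : nat -> G) (n : nat) :=
  fix avg (k : nat) (f : G -> R) : G -> R :=
    if k is k'.+1 then orbit_avg n (e k') (avg k' f) else f.

Lemma abelian_amenable (G : group) : countable_group G ->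
  (forall x y : G, gmul x y = gmul y x) -> amenable G.
Proof.
move=> [code code_inj] comm.
have [e eP] : exists e : nat -> G, forall g, exists i, e i = g.
  have /choice[e eP] : forall i, exists g : G, forall g', code g' = i -> g = g'.
    move=> i; have [[g gi]|ni] := pselect (exists g, code g = i).
      by exists g => g' g'i; apply: code_inj; rewrite gi g'i.
    by exists gone => g' g'i; case: ni; exists g'.
  by exists e => g; exists (code g); exact: eP.
have avg_bd n k (f : G -> R) C : (forall x, `|f x| <= C) ->
    forall x, `|multi_avg e n k f x| <= C.
  move=> fC; elim: k => // k IH x /=.
  exact: (mean_norm_le (mean_orbit_avg n (e k) x)).
have avg_mean n k x : is_mean (fun f => multi_avg e n k f x).
  have bd f : bounded_fun f -> bounded_fun (multi_avg e n k f).
    by move=> [C fC]; exists C; exact: avg_bd.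
  have mD f h : bounded_fun f -> bounded_fun h ->
      multi_avg e n k (fun x => f x + h x) =
      fun x => multi_avg e n k f x + multi_avg e n k h x.
    move=> bf bh; elim: k {bd} => //= k ->; apply/funext => y.
    by rewrite /orbit_avg big_split mulrDr.
  have mZ c f : multi_avg e n k (fun x => c * f x) =
      fun x => c * multi_avg e n k f x.
    elim: k {bd mD} => //= k ->; apply/funext => y.
    by rewrite /orbit_avg -mulr_sumr mulrCA.
  split=> [f h bf bh|c f bf|f bf f0|].
  - by rewrite mD.
  - by rewrite mZ.
  - elim: k x {bd mD mZ} => //= k IH x; rewrite mulr_ge0 ?invr_ge0 // sumr_ge0 //.
  - elim: k x {bd mD mZ} => //= k IH x.
    rewrite /orbit_avg (eq_bigr (fun=> 1)); last by move=> j _; rewrite IH.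
    by rewrite sumr_const card_ord mulVf // pnatr_eq0.
have avg_shift n k f h : multi_avg e n k (fun x => f (gmul x h)) =
    fun x => multi_avg e n k f (gmul x h).
  elim: k => //= k ->; apply/funext => x; rewrite /orbit_avg; congr (_ * _).
  by apply: eq_bigr => j _; rewrite -!gmulA (comm h).
(* Translation by [e i] commutes with the other averages; in the average along [e i] itself only two
   end terms survive. *)
have avg_inv n k i f C : (forall x, `|f x| <= C) -> (i < k)%N -> forall x,
    `|multi_avg e n k f (gmul x (e i)) - multi_avg e n k f x| <= n.+1%:R^-1 * (2 * C).
  move=> fC; elim: k => // k IH; rewrite ltnS leq_eqVlt => /orP[/eqP-> x|ik x] /=.
    rewrite /orbit_avg -mulrBr normrM ger0_norm ?invr_ge0 // ler_pM2l ?invr_gt0 ?ltr0n //.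
    rewrite big_ord_recr big_ord_recl /= gmul1r.
    rewrite (eq_bigr (fun j : 'I_n => multi_avg e n k f (gmul x (gpow (e k) (bump 0 j))))); last first.
      by move=> j _; rewrite -gmulA.
    have cancel_mid (a b c : R) : a + b - (c + a) = b - c by ring.
    rewrite cancel_mid.
    apply: le_trans (ler_normD _ _) _; rewrite normrN mulr2n mulrDl mul1r.
    by apply: lerD; exact: avg_bd.
  have -> : orbit_avg n (e k) (multi_avg e n k f) (gmul x (e i)) -
      orbit_avg n (e k) (multi_avg e n k f) x =
      orbit_avg n (e k) (fun y => multi_avg e n k f (gmul y (e i)) - multi_avg e n k f y) x.
    rewrite /orbit_avg -mulrBr -sumrB; congr (_ * _); apply: eq_bigr => j _.
    by rewrite -!gmulA (comm (e i)).
  apply: (mean_norm_le (mean_orbit_avg n (e k) x)); exact: IH.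
(* One index bounds both the exponents and the number of generators, so every element is eventually
   averaged over while the error 2C/(n+1) tends to 0. *)
apply: (@amenable_of_approx G (fun n f => multi_avg e n n f gone)) => [n|g f].
  exact: avg_mean.
move=> [C fC] eps eps0; have [i <-] := eP g.
have [N Nlt] : exists N : nat, 2 * C / eps <= N%:R.
  have [C0|C0] := leP (2 * C / eps) 0; first by exists 0%N.
  by exists (Num.truncn (2 * C / eps)).+1; rewrite ltW // truncnS_gt.
exists (maxn N i.+1) => n; rewrite geq_max => /andP[Nn iN].
rewrite avg_shift; apply: le_trans (avg_inv n n i f C fC iN gone) _.
rewrite mulrC ler_pdivrMr ?ltr0n // [leRHS]mulrC -ler_pdivrMr //.
apply: le_trans Nlt _; rewrite ler_nat; exact: leq_trans Nn _.
Qed.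

(** * Superharmonic functions on the cover of a labelled graph *)

Section LabelledGraph.
Variables (V : finType) (E : rel V) (G : group) (lab : V -> G).
Implicit Types (phi : V -> G -> R) (u v o : V) (g h : G) (w : seq V).

(* Adjacency operator of the covering graph on [V * G] with edges
   [(u, g) -> (v, g * lab u)]; it commutes with left translations of [G]. *)
Definition transfer phi : V -> G -> R :=
  fun u g => \sum_(v | E u v) phi v (gmul g (lab u)).

Definition dirac u g : V -> G -> R :=
  fun v h => ((v == u) && `[< h = g >])%:R.

Definition returns n u : R := iter n transfer (dirac u gone) u gone.

Fixpoint path_label u w : G :=
  if w is v :: w' then gmul (lab u) (path_label v w') else gone.

(** Strong connectivity of the cover. Nonempty walks give loops of positive length at each vertex,
    as [growth_returns_ge0] needs. *)
Definition label_irreducible : Prop := forall u v g, exists w : seq V,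
  [/\ w != [::], path E u w, last u w = v & path_label u w = g].

(** Says that [chi g * F v] is positive and [lam]-superharmonic for [transfer]: equivariance reduces
    the inequalities to finitely many, on [V]. *)
Definition twist_super (chi : G -> R) (F : V -> R) (lam : R) : Prop :=
  [/\ forall g, 0 < chi g, forall g h, chi (gmul g h) = chi g * chi h,
      forall v, 0 < F v &
      forall u, \sum_(v | E u v) chi (lab u) * F v <= lam * F u].

Lemma dirac_ge0 u g v h : 0 <= dirac u g v h.
Proof. by rewrite ler0n. Qed.

Lemma dirac_diag u g : dirac u g u g = 1.
Proof. by rewrite /dirac eqxx asboolT. Qed.

Lemma transfer_le phi1 phi2 : (forall v h, phi1 v h <= phi2 v h) ->
  forall v h, transfer phi1 v h <= transfer phi2 v h.
Proof. by move=> le12 v h; apply: ler_sum. Qed.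

Lemma iter_transfer_ge0 n phi : (forall v h, 0 <= phi v h) ->
  forall v h, 0 <= iter n transfer phi v h.
Proof. by move=> phi0; elim: n => // n IH v h /=; apply: sumr_ge0. Qed.

Lemma iter_transfer_le n phi1 phi2 : (forall v h, phi1 v h <= phi2 v h) ->
  forall v h, iter n transfer phi1 v h <= iter n transfer phi2 v h.
Proof. by move=> le12; elim: n => // n IH v h /=; apply: transfer_le. Qed.

Lemma transferZ (c : R) phi v h :
  transfer (fun v h => c * phi v h) v h = c * transfer phi v h.
Proof. by rewrite /transfer mulr_sumr. Qed.

Lemma iter_transferZ n (c : R) phi v h :
  iter n transfer (fun v h => c * phi v h) v h = c * iter n transfer phi v h.
Proof.
elim: n v h => //= n IH v h; rewrite -transferZ.
by congr (transfer _ v h); apply/funext => a; apply/funext => k.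
Qed.

Lemma iter_transfer_super n (lam : R) phi : 0 <= lam ->
  (forall v h, transfer phi v h <= lam * phi v h) ->
  forall v h, iter n transfer phi v h <= lam ^+ n * phi v h.
Proof.
move=> lam0 phiS; elim: n => [|n IH] v h; first by rewrite expr0 mul1r.
rewrite /= exprSr -mulrA; apply: le_trans (transfer_le IH v h) _.
by rewrite transferZ ler_wpM2l ?exprn_ge0.
Qed.

Lemma path_le_iter phi : (forall v h, 0 <= phi v h) -> forall w u g, path E u w ->
  phi (last u w) (gmul g (path_label u w)) <= iter (size w) transfer phi u g.
Proof.
move=> phi0; elim=> [|v w IH] u g /=; first by rewrite gmul1r.
move=> /andP[uv vw]; rewrite gmulA {1}/transfer (bigD1 v) //=.
apply: ler_wpDr; last exact: IH.
by apply: sumr_ge0 => a _; exact: iter_transfer_ge0.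
Qed.

(** With irreducibility, this bounds the ratio of two values by a constant that does not depend on
    the position [g]. *)
Lemma harnack (lam : R) phi : 0 <= lam -> (forall v h, 0 <= phi v h) ->
  (forall v h, transfer phi v h <= lam * phi v h) -> forall w u g, path E u w ->
  phi (last u w) (gmul g (path_label u w)) <= lam ^+ size w * phi u g.
Proof.
move=> lam0 phi0 phiS w u g uw.
by apply: le_trans (path_le_iter phi0 g uw) _; exact: iter_transfer_super.
Qed.

Lemma twist_super_chi1 chi F lam : twist_super chi F lam -> chi gone = 1.
Proof.
case=> chi0 chiM _ _; have := chiM gone gone; rewrite gmul1l.
by move=> /(congr1 (fun t => t / chi gone)); rewrite mulfK ?divff // gt_eqF.
Qed.

Lemma twist_super_transfer chi F lam : twist_super chi F lam -> forall v h,
  transfer (fun v h => chi h * F v) v h <= lam * (chi h * F v).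
Proof.
case=> chi0 chiM F0 FS v h; rewrite /transfer mulrCA.
rewrite (eq_bigr (fun a => chi h * (chi (lab v) * F a))); last first.
  by move=> a _; rewrite chiM mulrA.
by rewrite -mulr_sumr ler_pM2l.
Qed.

(** [dirac u gone] lies below the superharmonic function [chi h * F v / F u], whose value at
    [(u, gone)] is 1; hence the bound has no constant. *)
Lemma returns_twist_super chi F lam n u : 0 <= lam -> twist_super chi F lam ->
  returns n u <= lam ^+ n.
Proof.
move=> lam0 tw; have [chi0 chiM F0 FS] := tw.
have dle v h : dirac u gone v h <= (F u)^-1 * (chi h * F v).
  rewrite /dirac; case: eqP => [->|_] /=; last first.
    by rewrite mulr_ge0 ?invr_ge0 ?mulr_ge0 // ltW.
  case: asboolP => [->|_] /=; last by rewrite mulr_ge0 ?invr_ge0 ?mulr_ge0 // ltW.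
  by rewrite (twist_super_chi1 tw) mul1r mulVf // gt_eqF.
apply: le_trans (iter_transfer_le n dle u gone) _; rewrite iter_transferZ.
apply: le_trans (_ : (F u)^-1 * (lam ^+ n * (chi gone * F u)) <= _).
  rewrite ler_pM2l ?invr_gt0 //; apply: iter_transfer_super => //.
  exact: twist_super_transfer.
by rewrite (twist_super_chi1 tw) mul1r mulrCA mulVf ?mulr1 // gt_eqF.
Qed.

Lemma positive_superharmonic o (C mu lam : R) : label_irreducible ->
  0 < mu -> mu < lam -> (forall n, returns n o <= C * mu ^+ n) ->
  exists f : V -> G -> R, (forall v h, 0 < f v h) /\
    (forall v h, transfer f v h <= lam * f v h).
Proof.
move=> irr mu0 mulam Hret.
pose k (x : V * G) v : R := (E x.1 v)%:R.
pose s (x : V * G) v : V * G := (v, gmul x.2 (lab x.1)).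
pose U n (x : V * G) : R := iter n transfer (dirac o gone) x.1 x.2.
have transferE phi u g :
    transfer phi u g = \sum_v k (u, g) v * phi (s (u, g) v).1 (s (u, g) v).2.
  rewrite /transfer big_mkcond; apply: eq_bigr => v _; rewrite /k /=.
  by case: (E u v); rewrite ?mul1r ?mul0r.
have [f [Uf fS]] : exists f : V * G -> R, (forall n x, U n x <= lam ^+ n * f x) /\
    (forall x, \sum_v k x v * f (s x v) <= lam * f x).
  apply: (@superharmonic_of_orbit R _ V k s U mu) => //.
  - by move=> n x; apply: iter_transfer_ge0; exact: dirac_ge0.
  - by move=> n [u g]; rewrite /U /= transferE.
  (* A walk from [(u, g)] to [(o, gone)], preceded by a fixed walk from [(o, gone)] to [(u, g)], is
     a return to [o]. *)
  - move=> [u g]; have [w [_ ow lw lg]] := irr o u g.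
    exists (C * mu ^+ size w) => n; rewrite -mulrA -exprD.
    apply: le_trans (Hret (size w + n)%N).
    have := path_le_iter (iter_transfer_ge0 n (dirac_ge0 o gone)) gone ow.
    by rewrite lw lg gmul1l -iterD.
exists (fun v h => f (v, h)); split=> v h; last by rewrite transferE; exact: fS.
(* A walk from [(v, h)] to [(o, gone)] makes one term of the series positive. *)
have [w [_ vw lw lg]] := irr v o (ginv h).
have := path_le_iter (dirac_ge0 o gone) h vw; rewrite lw lg gmulVr dirac_diag.
move=> /le_trans /(_ (Uf (size w) (v, h))) /(lt_le_trans ltr01).
by rewrite pmulr_rgt0 // exprn_gt0 // (lt_trans mu0).
Qed.

(* The geometric mean, over left translates, of a positive superharmonic function
   is superharmonic by Jensen, and equivariant under a character of [G]. *)
Lemma amenable_twist_super o (C mu lam : R) : amenable G -> label_irreducible ->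
  0 < mu -> mu < lam -> (forall n, returns n o <= C * mu ^+ n) ->
  exists chi F, twist_super chi F lam.
Proof.
move=> /amenable_right_mean[m [mm minv]] irr mu0 mulam Hret.
have [f [f0 fS]] := positive_superharmonic irr mu0 mulam Hret.
have lam0 : 0 < lam by exact: lt_trans mulam.
(* Harnack bounds differences of logarithms, not [ln f] itself, so the mean is applied to
   differences only. [mtrans] makes their means a potential, and [mshift] makes that potential
   equivariant. *)
pose D a g b k h := ln (f a (gmul h g)) - ln (f b (gmul h k)).
have ratio a g b k : exists2 c : R, 0 < c &
    forall h, f a (gmul h g) <= c * f b (gmul h k).
  have [w [_ bw lw lg]] := irr b a (gmul (ginv k) g).
  exists (lam ^+ size w); first by rewrite exprn_gt0.
  move=> h; have := @harnack lam f (ltW lam0) (fun v h => ltW (f0 v h)) fS _ _ (gmul h k) bw.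
  by rewrite lw lg -gmulA (gmulA k) gmulVr gmul1l.
have bD a g b k : bounded_fun (D a g b k).
  have [c c0 cP] := ratio a g b k; have [d d0 dP] := ratio b k a g.
  have lnle (x y t : R) : 0 < x -> 0 < y -> 0 < t -> x <= t * y -> ln x - ln y <= `|ln t|.
    move=> x0 y0 t0 xy; apply: le_trans (_ : ln t <= _); last exact: ler_norm.
    by rewrite lerBlDr -lnM ?posrE // ler_ln ?posrE // mulr_gt0.
  exists (`|ln c| + `|ln d|) => h; rewrite ler_norml; apply/andP; split.
    rewrite lerNl opprB; apply: le_trans (lnle _ _ d _ _ _ (dP h)) _ => //.
    by rewrite lerDr.
  by apply: le_trans (lnle _ _ c _ _ _ (cP h)) _ => //; rewrite lerDl.
have mtrans a g b k c l : m (D a g b k) + m (D b k c l) = m (D a g c l).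
  have [mD _ _ _] := mm; rewrite -mD //; congr m; apply/funext => h.
  by rewrite /D addrA subrK.
have mshift j a g b k : m (D a (gmul j g) b (gmul j k)) = m (D a g b k).
  rewrite -(minv j (D a g b k)) //; congr m; apply/funext => h.
  by rewrite /D !gmulA.
exists (fun g => expR (m (D o g o gone))), (fun v => expR (m (D v gone o gone))).
split=> [g|g h|v|u]; try exact: expR_gt0.
  rewrite -exp.expRD; congr expR.
  rewrite -(mtrans o (gmul g h) o (gmul g gone)) mshift gmul1r addrC //.
pose q v := m (D v (lab u) u gone).
rewrite (eq_bigr (fun v => expR (m (D u gone o gone)) * expR (q v))); last first.
  move=> v _; rewrite -!exp.expRD; congr expR.
  rewrite -(mshift (lab u) v) !gmul1r addrC (mtrans v) addrC /q.
  by rewrite mtrans.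
rewrite -mulr_sumr mulrC ler_pM2r ?expR_gt0 //.
have expD v h : expR (D v (lab u) u gone h) = f v (gmul h (lab u)) / f u h.
  by rewrite /D exp.expRD expRN !lnK ?posrE // gmul1r.
have be v : bounded_fun (fun h => expR (D v (lab u) u gone h)).
  have [c c0 cP] := ratio v (lab u) u gone; exists c => h.
  by rewrite expD ger0_norm ?divr_ge0 ?(ltW (f0 _ _)) // ler_pdivrMr // -{2}(gmul1r h).
apply: (@le_trans _ _ (\sum_(v | E u v) m (fun h => expR (D v (lab u) u gone h)))).
  by apply: ler_sum => v _; exact: expR_mean_le.
have [bs <-] := @mean_sum _ m _ (index_enum V) (E u) _ mm be.
rewrite -[leRHS](mean_cst lam mm); apply: mean_le => //; first exact: bounded_fun_cst.
move=> h; rewrite (eq_bigr _ (fun v _ => expD v h)) -mulr_suml ler_pdivrMr //.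
exact: fS.
Qed.

End LabelledGraph.

(** * Finitely supported functions and their sums *)

(** [{classic X}] supplies the decidable equality that the carrier of an abstract group lacks. *)
Definition finsupp (X : Type) (f : X -> R) : Prop :=
  exists s : seq {classic X}, forall x, x \notin s -> f x = 0.

Definition fsum (X : Type) (f : X -> R) : R :=
  \sum_(x \in [set: {classic X}]) f x.

Lemma fsumE (X : Type) (f : X -> R) (s : seq {classic X}) : uniq s ->
  (forall x, x \notin s -> f x = 0) -> fsum f = \sum_(x <- s) f x.
Proof.
move=> us f0; rewrite /fsum (fsbigE s) //; last by move=> x _; exact: f0.
by apply: eq_bigl => x; rewrite in_setT.
Qed.

Lemma finsupp2 (X : Type) (f g : X -> R) : finsupp f -> finsupp g ->
  exists s : seq {classic X}, [/\ uniq s, forall x, x \notin s -> f x = 0 &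
    forall x, x \notin s -> g x = 0].
Proof.
move=> [s fs] [t gt]; exists (undup (s ++ t)); rewrite undup_uniq.
split=> // x; rewrite mem_undup mem_cat negb_or => /andP[xs xt]; [exact: fs|exact: gt].
Qed.

Lemma finsupp_sub (X : Type) (f g : X -> R) : finsupp f ->
  (forall x, f x = 0 -> g x = 0) -> finsupp g.
Proof. by move=> [s fs] fg; exists s => x xs; apply/fg/fs. Qed.

Lemma finsupp_comb (X : Type) (f g h : X -> R) : finsupp f -> finsupp g ->
  (forall x, f x = 0 -> g x = 0 -> h x = 0) -> finsupp h.
Proof.
by move=> ff fg H; have [s [_ sf sg]] := finsupp2 ff fg; exists s => x xs; apply: H; auto.
Qed.

Lemma finsuppD (X : Type) (f g : X -> R) : finsupp f -> finsupp g ->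
  finsupp (fun x => f x + g x).
Proof. by move=> ff fg; apply: (finsupp_comb ff fg) => x -> ->; rewrite addr0. Qed.

Lemma finsuppZ (X : Type) (c : R) (f : X -> R) : finsupp f ->
  finsupp (fun x => c * f x).
Proof. by move=> ff; apply: (finsupp_sub ff) => x ->; rewrite mulr0. Qed.

Lemma finsupp_sqr (X : Type) (f : X -> R) : finsupp f -> finsupp (fun x => f x ^+ 2).
Proof. by move=> ff; apply: (finsupp_sub ff) => x ->; rewrite expr0n. Qed.

Lemma fsumD (X : Type) (f g : X -> R) : finsupp f -> finsupp g ->
  fsum (fun x => f x + g x) = fsum f + fsum g.
Proof.
move=> ff fg; have [s [us sf sg]] := finsupp2 ff fg.
rewrite !(@fsumE _ _ s) ?big_split // => x xs.
by rewrite sf ?sg ?addr0.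
Qed.

Lemma fsumZ (X : Type) (c : R) (f : X -> R) : finsupp f ->
  fsum (fun x => c * f x) = c * fsum f.
Proof.
move=> ff; have [s [us sf _]] := finsupp2 ff ff.
rewrite !(@fsumE _ _ s) ?mulr_sumr // => x xs.
by rewrite sf ?mulr0.
Qed.

Lemma fsum_ge0 (X : Type) (f : X -> R) : (forall x, 0 <= f x) -> 0 <= fsum f.
Proof. by move=> f0; apply: fsumr_ge0. Qed.

Lemma fsum_le (X : Type) (f g : X -> R) : finsupp f -> finsupp g ->
  (forall x, f x <= g x) -> fsum f <= fsum g.
Proof.
move=> ff fg le; have [s [us sf sg]] := finsupp2 ff fg.
by rewrite !(@fsumE _ _ s) //; apply: ler_sum.
Qed.

Lemma fsum_norm_le (X : Type) (f g : X -> R) : finsupp f -> finsupp g ->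
  (forall x, `|f x| <= g x) -> `|fsum f| <= fsum g.
Proof.
move=> ff fg le; rewrite ler_norml -mulN1r -fsumZ //.
rewrite !fsum_le //; try exact: finsuppZ.
  by move=> x; have := le x; rewrite ler_norml ?mulN1r => /andP[].
by move=> x; have := le x; rewrite ler_norml ?mulN1r => /andP[].
Qed.

Lemma fsum_term_le (X : Type) (f : X -> R) (x : X) : finsupp f ->
  (forall x, 0 <= f x) -> f x <= fsum f.
Proof.
move=> [s sf] f0; pose t : seq {classic X} := undup ((x : {classic X}) :: s).
have tf (y : {classic X}) : y \notin t -> f y = 0.
  by rewrite mem_undup inE negb_or => /andP[_]; exact: sf.
have xt : (x : {classic X}) \in t by rewrite mem_undup inE eqxx.
rewrite (fsumE (undup_uniq _) tf) (bigD1_seq _ xt) ?undup_uniq //= lerDl.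
exact: sumr_ge0.
Qed.

Lemma finsupp_sum (X I : Type) (r : seq I) (P : pred I) (f : I -> X -> R) :
  (forall i, finsupp (f i)) -> finsupp (fun x => \sum_(i <- r | P i) f i x) /\
  fsum (fun x => \sum_(i <- r | P i) f i x) = \sum_(i <- r | P i) fsum (f i).
Proof.
move=> ff; elim: r => [|i r [IHf IH]].
  rewrite big_nil; split; first by exists [::] => x _; rewrite big_nil.
  rewrite (@fsumE _ _ [::]) ?big_nil // => x _; by rewrite big_nil.
have -> : (fun x => \sum_(j <- i :: r | P j) f j x) =
    fun x => (if P i then f i x else 0) + \sum_(j <- r | P j) f j x.
  by apply/funext => x; rewrite big_cons; case: ifP; rewrite ?add0r.
rewrite big_cons; case: (P i); first by split; [exact: finsuppD|rewrite fsumD ?IH].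
by under eq_fun do rewrite add0r.
Qed.

Lemma finsupp_shift (G : group) (k : G) (f : G -> R) : finsupp f ->
  finsupp (fun x => f (gmul x k)).
Proof.
move=> [s fs]; exists [seq (gmul x (ginv k) : {classic G}) | x <- s] => x xs.
apply: fs; apply: contra xs => xk; apply/(@mapP {classic G} {classic G}); exists (gmul x k) => //.
by rewrite -gmulA gmulVr gmul1r.
Qed.

Lemma fsum_shift (G : group) (k : G) (f : G -> R) :
  fsum (fun x => f (gmul x k)) = fsum f.
Proof.
rewrite /fsum [RHS](@reindex_fsbigT _ _ _ {classic G} {classic G} (fun x => gmul x k)) //.
exists (fun x => gmul x (ginv k)) => x.
  by rewrite -gmulA gmulVr gmul1r.
by rewrite -gmulA gmulVl gmul1r.
Qed.

(** * Inequalities behind the lazy walk *)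

(** The weighted variance about [m] is nonnegative, and mass missing from 1 only helps. *)
Lemma sqr_sum_le (I : finType) (P : pred I) (p y : I -> R) :
  (forall i, P i -> 0 <= p i) -> \sum_(i | P i) p i <= 1 ->
  (\sum_(i | P i) p i * y i) ^+ 2 <= \sum_(i | P i) p i * y i ^+ 2.
Proof.
move=> p0 p1; set m := \sum_(i | P i) p i * y i; rewrite -subr_ge0.
have : 0 <= \sum_(i | P i) p i * (y i - m) ^+ 2.
  by apply: sumr_ge0 => i Pi; rewrite mulr_ge0 ?p0 ?sqr_ge0.
have -> : \sum_(i | P i) p i * (y i - m) ^+ 2 =
    \sum_(i | P i) p i * y i ^+ 2 - 2 * m * m + (\sum_(i | P i) p i) * m ^+ 2.
  rewrite -/m; transitivity (\sum_(i | P i) (p i * y i ^+ 2 - 2 * m * (p i * y i) + p i * m ^+ 2)).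
    by apply: eq_bigr => i _; ring.
  by rewrite big_split sumrB -mulr_sumr -mulr_suml.
move=> H; apply: le_trans H _.
have := sqr_ge0 m; nra.
Qed.

(** With [m] the weighted sum of the [y i], the terms [2 x m] cancel between the two squares, as in
    the parallelogram law; what remains is [sqr_sum_le] and total mass at most 1. *)
Lemma lazy_sqr_le (I : finType) (P : pred I) (p y : I -> R) (x : R) :
  (forall i, P i -> 0 <= p i) -> \sum_(i | P i) p i <= 1 ->
  (x + \sum_(i | P i) p i * y i) ^+ 2 + \sum_(i | P i) p i * (y i - x) ^+ 2 <=
  2 * x ^+ 2 + \sum_(i | P i) 2 * p i * y i ^+ 2.
Proof.
move=> p0 p1; have := sqr_sum_le y p0 p1.
have -> : \sum_(i | P i) p i * (y i - x) ^+ 2 = \sum_(i | P i) p i * y i ^+ 2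
    - 2 * x * (\sum_(i | P i) p i * y i) + (\sum_(i | P i) p i) * x ^+ 2.
  transitivity (\sum_(i | P i) (p i * y i ^+ 2 - 2 * x * (p i * y i) + p i * x ^+ 2)).
    by apply: eq_bigr => i _; ring.
  by rewrite big_split sumrB -mulr_sumr -mulr_suml.
have -> : \sum_(i | P i) 2 * p i * y i ^+ 2 = 2 * \sum_(i | P i) p i * y i ^+ 2.
  by rewrite mulr_sumr; apply: eq_bigr => i _; rewrite mulrA.
have := sqr_ge0 x; nra.
Qed.

(** Induction through (k+1) C(2k+2,k+1) = 2 (2k+1) C(2k,k). The loss of 2k+1 against 4^k is
    invisible to exponential rates. *)
Lemma central_bin_lower k : (4 ^ k <= (2 * k).+1 * 'C(2 * k, k))%N.
Proof.
elim: k => // k IH.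
have e : (k.+1 * 'C(2 * k.+1, k.+1) = 2 * (2 * k).+1 * 'C(2 * k, k))%N.
  have /= := mul_bin_diag (2 * k).+2 k; have /= := mul_bin_diag (2 * k).+1 k.
  have := bin_sub (leq_addl k.+1 k).
  rewrite (_ : (2 * k.+1 = (2 * k).+2)%N); last lia.
  set X := 'C((2 * k).+2, _); set Y := 'C(2 * k, k).
  move=> h0 h1 h2.
  have h3 : 'C((2 * k).+1, k.+1) = 'C((2 * k).+1, k).
    rewrite (_ : ((2 * k).+1 = k.+1 + k)%N); last lia.
    by rewrite -h0 addnK.
  move: h1 h2; rewrite h3; set Z := 'C(_, k) => h1 h2.
  by rewrite -h2 -mulnA h1; lia.
rewrite expnS; nia.
Qed.

(** * The Doob transform and its lazy walk *)

Section LazyWalk.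
Variables (V : finType) (E : rel V) (G : group) (lab : V -> G).
Implicit Types (f phi : V -> G -> R) (u v o a b : V) (g h : G) (w : seq V).

Definition left_super (chi : G -> R) (pi : V -> R) (lam : R) : Prop :=
  (forall v, 0 < pi v) /\
  forall b, \sum_(a | E a b) chi (lab a) * pi a <= lam * pi b.

(** Paired with [F], the transposed orbit of a Dirac mass at [o] is at most [mu ^+ n * F o], so its
    resolvent series at [lam] converges; the gap between [mu] and [lam] is spent here. *)
Lemma exists_left_super chi F (mu lam : R) o : label_irreducible E lab ->
  twist_super E lab chi F mu -> 0 < mu -> mu < lam ->
  exists pi, left_super chi pi lam.
Proof.
move=> irr [chi0 chiM F0 FS] mu0 mulam.
pose k b a : R := (E a b)%:R * chi (lab a).
pose T (q : V -> R) : V -> R := fun b => \sum_a k b a * q a.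
pose U n : V -> R := iter n T (fun b => (b == o)%:R).
have k0 b a : 0 <= k b a by rewrite mulr_ge0 ?ler0n // ltW.
have U0 n b : 0 <= U n b.
  by elim: n b => [|n IH] b; [rewrite ler0n | apply: sumr_ge0 => a _; rewrite mulr_ge0].
have UF n : \sum_b U n b * F b <= mu ^+ n * F o.
  elim: n => [|n IH].
    rewrite (bigD1 o) //= eqxx !mul1r big1 ?addr0 // => b /negPf bo.
    by rewrite /U /= bo mul0r.
  have -> : \sum_b U n.+1 b * F b =
      \sum_a U n a * \sum_(b | E a b) chi (lab a) * F b.
    rewrite (eq_bigr (fun b => \sum_a k b a * U n a * F b)); last first.
      by move=> b _; rewrite [U n.+1 b]/(T (U n) b) /T mulr_suml.
    rewrite exchange_big; apply: eq_bigr => a _ /=.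
    rewrite [in RHS]big_mkcond mulr_sumr; apply: eq_bigr => b _.
    by rewrite /k; case: (E a b); rewrite ?mul0r ?mulr0 // mul1r mulrCA mulrA.
  apply: (@le_trans _ _ (\sum_a U n a * (mu * F a))).
    by apply: ler_sum => a _; rewrite ler_wpM2l.
  rewrite (eq_bigr (fun a => mu * (U n a * F a))); last by move=> a _; rewrite mulrCA.
  by rewrite -mulr_sumr exprS -mulrA ler_pM2l.
have Upath w a n : 0 < U n a -> path E a w -> 0 < U (size w + n)%N (last a w).
  elim: w a n => // b w IH a n Ua /andP[ab bw].
  rewrite [size _]/= [last _ _]/= addSnnS; apply: IH => //.
  rewrite [U n.+1 b]/(T (U n) b) /T (bigD1 a) //=; apply: ltr_wpDr.
    by apply: sumr_ge0 => c _; rewrite mulr_ge0.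
  by rewrite /k ab mul1r mulr_gt0.
have [pi [Upi piS]] : exists pi : V -> R, (forall n b, U n b <= lam ^+ n * pi b) /\
    (forall b, \sum_a k b a * pi a <= lam * pi b).
  apply: (@superharmonic_of_orbit R V V k (fun b a => a) U mu) => // b.
  exists (F o / F b) => n; rewrite mulrAC ler_pdivlMr //.
  apply: le_trans (_ : \sum_b U n b * F b <= _); last by rewrite mulrC.
  by rewrite (bigD1 b) //= lerDl; apply: sumr_ge0 => c _; rewrite mulr_ge0 // ltW.
exists pi; split=> b.
  have [w [_ ow lw _]] := irr o b gone.
  have /Upath/(_ ow) : 0 < U 0%N o by rewrite /U /= eqxx ltr01.
  rewrite lw => /lt_le_trans/(_ (Upi _ b)).
  by rewrite pmulr_rgt0 // exprn_gt0 // (lt_trans mu0).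
apply: le_trans (piS b); rewrite big_mkcond; apply: ler_sum => a _.
by rewrite /k; case: (E a b); rewrite ?mul1r ?mul0r.
Qed.

Section Doob.
Variables (chi : G -> R) (F pi : V -> R) (lam : R).
Hypotheses (lam0 : 0 < lam) (tw : twist_super E lab chi F lam)
  (lf : left_super chi pi lam).

Let chi0 g : 0 < chi g. Proof. by case: tw. Qed.
Let F0 v : 0 < F v. Proof. by case: tw. Qed.
Let pi0 v : 0 < pi v. Proof. by case: lf. Qed.

(** For eigenvectors this product would be the stationary measure of the Doob walk; here it is
    sub-invariant, by [cond_sum_le]. *)
Definition nu v : R := pi v * F v.
(** The position [h] cancels from the Doob transform by [chi], so the weights live on [V] and [doob]
    still commutes with left translations of [G]. *)
Definition prob a b : R := chi (lab a) * F b / (lam * F a).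
Definition cond a b : R := nu a * prob a b.
Definition doob phi : V -> G -> R :=
  fun a h => \sum_(b | E a b) prob a b * phi b (gmul h (lab a)).
Definition lazy phi : V -> G -> R := fun a h => phi a h + doob phi a h.
Definition norm2 f : R := \sum_a nu a * fsum (fun h => f a h ^+ 2).
(** The Dirichlet form of the Doob walk on the cover. *)
Definition energy f : R := \sum_a \sum_(b | E a b)
  cond a b * fsum (fun h => (f b (gmul h (lab a)) - f a h) ^+ 2).

Lemma nu_gt0 v : 0 < nu v.
Proof. exact: mulr_gt0. Qed.

Lemma prob_gt0 a b : 0 < prob a b.
Proof. by rewrite divr_gt0 // mulr_gt0. Qed.

Lemma cond_gt0 a b : 0 < cond a b.
Proof. by rewrite mulr_gt0 ?nu_gt0 ?prob_gt0. Qed.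

Lemma prob_sum_le1 a : \sum_(b | E a b) prob a b <= 1.
Proof.
by rewrite -mulr_suml ler_pdivrMr ?mulr_gt0 // mul1r; case: tw.
Qed.

Lemma cond_sum_le b : \sum_(a | E a b) cond a b <= nu b.
Proof.
rewrite (eq_bigr (fun a => chi (lab a) * pi a * (F b / lam))); last first.
  move=> a _; rewrite /cond /nu /prob; have := F0 a; have := lam0 => l0 Fa.
  by field; rewrite !gt_eqF.
rewrite -mulr_suml; have [_ /(_ b) lfS] := lf.
apply: (@le_trans _ _ (lam * pi b * (F b / lam))).
  by apply: ler_wpM2r => //; rewrite divr_ge0 // ltW.
by rewrite /nu [lam * _]mulrC -mulrA [lam * _]mulrC divfK ?gt_eqF.
Qed.

Lemma energy_ge0 f : 0 <= energy f.
Proof.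
apply: sumr_ge0 => a _; apply: sumr_ge0 => b _; rewrite mulr_ge0 ?(ltW (cond_gt0 a b)) //.
by apply: fsum_ge0 => h; exact: sqr_ge0.
Qed.

Lemma finsupp_doob f : (forall a, finsupp (f a)) -> forall a, finsupp (doob f a).
Proof.
move=> ff a.
by have [] := @finsupp_sum G V (index_enum V) (E a)
  (fun b h => prob a b * f b (gmul h (lab a))) (fun b => finsuppZ _ (finsupp_shift _ (ff b))).
Qed.

Lemma finsupp_lazy f : (forall a, finsupp (f a)) -> forall a, finsupp (lazy f a).
Proof. by move=> ff a; apply: finsuppD => //; exact: finsupp_doob. Qed.

Lemma finsupp_diff f : (forall a, finsupp (f a)) -> forall a b k,
  finsupp (fun h => (f b (gmul h k) - f a h) ^+ 2).
Proof.
move=> ff a b k; apply: finsupp_sqr; apply: finsuppD; first exact: finsupp_shift.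
by apply: (finsupp_sub (ff a)) => x ->; rewrite oppr0.
Qed.

(** Sum [lazy_sqr_le] over [G] and against [nu]. Row sums are controlled through [F], column sums
    through [pi], and the shift by [lab a] disappears in the sum over [G]. *)
Lemma norm2_lazy f : (forall a, finsupp (f a)) ->
  norm2 (lazy f) + energy f <= 4 * norm2 f.
Proof.
move=> ff.
have loc a : fsum (fun h => lazy f a h ^+ 2) + \sum_(b | E a b)
      prob a b * fsum (fun h => (f b (gmul h (lab a)) - f a h) ^+ 2) <=
    2 * fsum (fun h => f a h ^+ 2) +
      \sum_(b | E a b) 2 * prob a b * fsum (fun h => f b h ^+ 2).
  have [s1 e1] := @finsupp_sum G V (index_enum V) (E a)
    (fun b h => prob a b * (f b (gmul h (lab a)) - f a h) ^+ 2)
    (fun b => finsuppZ _ (finsupp_diff ff a b (lab a))).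
  have [s2 e2] := @finsupp_sum G V (index_enum V) (E a)
    (fun b h => 2 * prob a b * f b (gmul h (lab a)) ^+ 2)
    (fun b => finsuppZ _ (finsupp_sqr (finsupp_shift _ (ff b)))).
  have fa2 := finsupp_sqr (ff a); have fl2 := finsupp_sqr (finsupp_lazy ff a).
  have -> : \sum_(b | E a b) prob a b * fsum (fun h => (f b (gmul h (lab a)) - f a h) ^+ 2) =
      fsum (fun h => \sum_(b | E a b) prob a b * (f b (gmul h (lab a)) - f a h) ^+ 2).
    rewrite e1; apply: eq_bigr => b _; rewrite fsumZ //; exact: finsupp_diff.
  have -> : \sum_(b | E a b) 2 * prob a b * fsum (fun h => f b h ^+ 2) =
      fsum (fun h => \sum_(b | E a b) 2 * prob a b * f b (gmul h (lab a)) ^+ 2).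
    rewrite e2; apply: eq_bigr => b _.
    rewrite fsumZ; last exact: (finsupp_sqr (finsupp_shift _ (ff b))).
    by rewrite (fsum_shift (lab a) (fun h => f b h ^+ 2)).
  rewrite -fsumZ // -!fsumD //; last exact: finsuppZ.
  apply: fsum_le; [exact: finsuppD | by apply: finsuppD => //; exact: finsuppZ | ].
  move=> h; apply: lazy_sqr_le => [b _|]; [exact: (ltW (prob_gt0 a b)) | exact: prob_sum_le1].
have := @ler_sum _ _ (index_enum V) xpredT _ _
  (fun a _ => ler_wpM2l (ltW (nu_gt0 a)) (loc a)).
have -> : \sum_a nu a * (fsum (fun h => lazy f a h ^+ 2) + \sum_(b | E a b)
    prob a b * fsum (fun h => (f b (gmul h (lab a)) - f a h) ^+ 2)) =
    norm2 (lazy f) + energy f.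
  rewrite /norm2 /energy -big_split; apply: eq_bigr => a _ /=.
  by rewrite mulrDr [X in _ + X = _]mulr_sumr; congr (_ + _); apply: eq_bigr => b _; rewrite mulrA.
move=> /le_trans; apply.
have -> : \sum_a nu a * (2 * fsum (fun h => f a h ^+ 2) +
      \sum_(b | E a b) 2 * prob a b * fsum (fun h => f b h ^+ 2)) =
    2 * norm2 f + 2 * \sum_b (\sum_(a | E a b) cond a b) * fsum (fun h => f b h ^+ 2).
  under eq_bigr do rewrite mulrDr.
  rewrite big_split /=; congr (_ + _).
    by rewrite /norm2 mulr_sumr; apply: eq_bigr => a _; rewrite mulrCA.
  transitivity (\sum_a \sum_(b | E a b) 2 * (cond a b * fsum (fun h => f b h ^+ 2))).
    apply: eq_bigr => a _; rewrite mulr_sumr; apply: eq_bigr => b _.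
    by rewrite /cond; ring.
  rewrite (exchange_big_dep xpredT) //= mulr_sumr; apply: eq_bigr => b _.
  by rewrite -mulr_sumr mulr_suml.
have : \sum_b (\sum_(a | E a b) cond a b) * fsum (fun h => f b h ^+ 2) <= norm2 f.
  apply: ler_sum => b _; apply: ler_wpM2r; last exact: cond_sum_le.
  by apply: fsum_ge0 => h; exact: sqr_ge0.
lra.
Qed.

(** Conjugation by [chi h * F a] and division by [lam]. On the diagonal the conjugation disappears,
    which gives [returns_doob]. *)
Lemma doob_transfer n phi a h : chi h * F a * iter n doob phi a h * lam ^+ n =
  iter n (transfer E lab) (fun a h => chi h * F a * phi a h) a h.
Proof.
elim: n a h => [|n IH] a h; first by rewrite expr0 mulr1.
rewrite /= /transfer /doob mulr_sumr mulr_suml; apply: eq_bigr => b _.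
rewrite -IH exprS; have [_ chiM _ _] := tw; rewrite chiM /prob.
by have Fa := F0 a; have l0 := lam0; field; rewrite !gt_eqF.
Qed.

Lemma returns_doob n u : returns E lab n u = iter n doob (dirac u gone) u gone * lam ^+ n.
Proof.
have chi1 := twist_super_chi1 tw.
have Fu : F u != 0 by rewrite gt_eqF.
apply: (mulfI Fu); rewrite mulrA -[F u in RHS]mul1r -chi1 doob_transfer.
rewrite /returns -iter_transferZ; congr (iter n _ _ u gone).
apply/funext => v; apply/funext => h; rewrite /dirac.
case: eqP => [->|_] /=; last by rewrite !mulr0.
by case: asboolP => [->|_] /=; rewrite ?mulr0 // chi1 mul1r.
Qed.

Lemma iter_doob_ge0 n phi : (forall a h, 0 <= phi a h) ->
  forall a h, 0 <= iter n doob phi a h.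
Proof.
move=> phi0; elim: n => //= n IH a h; apply: sumr_ge0 => b _.
by rewrite mulr_ge0 // ltW // prob_gt0.
Qed.

(** One term of the binomial expansion of (1 + P)^n, isolated by Pascal's rule because all terms are
    nonnegative. *)
Lemma bin_doob_le_lazy n k phi : (forall a h, 0 <= phi a h) ->
  forall a h, 'C(n, k)%:R * iter k doob phi a h <= iter n lazy phi a h.
Proof.
move=> phi0; have lazy0 m a h : 0 <= iter m lazy phi a h.
  elim: m a h => //= m IH a h; rewrite addr_ge0 // sumr_ge0 // => b _.
  by rewrite mulr_ge0 // ltW // prob_gt0.
elim: n k => [|n IH] k a h.
  by case: k => [|k]; rewrite ?mul1r // bin0n mul0r.
rewrite [iter n.+1 lazy phi a h]/(iter n lazy phi a h + doob (iter n lazy phi) a h).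
have doob_ge0 : 0 <= doob (iter n lazy phi) a h.
  by apply: sumr_ge0 => b _; rewrite mulr_ge0 // ltW // prob_gt0.
case: k => [|k]; first by rewrite bin0; apply: ler_wpDr => //; have := IH 0%N a h; rewrite bin0.
rewrite binS natrD mulrDl; apply: lerD; first exact: IH.
rewrite [iter k.+1 doob phi a h]/(doob (iter k doob phi) a h) /doob mulr_sumr.
apply: ler_sum => b _; rewrite mulrCA ler_wpM2l //; exact: (ltW (prob_gt0 a b)).
Qed.

Lemma finsupp_dirac u g a : finsupp (dirac u g a : G -> R).
Proof.
exists [:: (g : {classic G})] => h; rewrite inE /dirac => /eqP hg.
by rewrite asboolF ?andbF.
Qed.

Lemma norm2_dirac u g : norm2 (dirac u g) = nu u.
Proof.
rewrite /norm2 (bigD1 u) //= big1 ?addr0; last first.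
  move=> a /negPf au; rewrite (@fsumE _ _ [::]) ?big_nil ?mulr0 // => h _.
  by rewrite /dirac au expr0n.
rewrite (@fsumE _ _ [:: (g : {classic G})]) // ?big_seq1 ?dirac_diag ?expr1n ?mulr1 //.
move=> h; rewrite inE /dirac => /eqP hg.
by rewrite asboolF ?andbF ?expr0n.
Qed.

(* If the energy controlled the norm, the lazy operator would contract [l^2], so
   its return weights, hence those of the walk itself, would decay too fast. *)
Lemma exists_low_energy (eps : R) k u : 0 <= eps -> eps <= 4 ->
  (2 * k).+1%:R * (lam * (1 - eps / 4)) ^+ k < returns E lab k u ->
  exists f, (forall a, finsupp (f a)) /\ energy f < eps * norm2 f.
Proof.
move=> eps0 eps4 big; apply: contrapT => nex.
have en f : (forall a, finsupp (f a)) -> eps * norm2 f <= energy f.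
  by move=> ff; rewrite leNgt; apply/negP => lt; apply: nex; exists f.
pose d := dirac u gone : V -> G -> R.
have it n : (forall a, finsupp (iter n lazy d a)) /\
    norm2 (iter n lazy d) <= (4 - eps) ^+ n * nu u.
  elim: n => [|n [IHf IH]].
    by split; [exact: finsupp_dirac | rewrite expr0 mul1r norm2_dirac].
  split; first exact: finsupp_lazy.
  have := norm2_lazy IHf; have := en _ IHf => h1 h2.
  have : norm2 (iter n.+1 lazy d) <= (4 - eps) * norm2 (iter n lazy d) by lra.
  move=> /le_trans; apply; rewrite exprS -mulrA ler_wpM2l //; lra.
have d0 a h : 0 <= d a h by exact: dirac_ge0.
(* One value is bounded by the whole norm; the square root turns the exponent [2 * k] into [k]. *)
have lazyb : iter (2 * k) lazy d u gone <= (4 - eps) ^+ k.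
  have [fs nb] := it (2 * k)%N.
  have : nu u * iter (2 * k) lazy d u gone ^+ 2 <= nu u * (4 - eps) ^+ (2 * k).
    rewrite [leRHS]mulrC; apply: le_trans nb; rewrite /norm2 (bigD1 u) //=.
    apply: ler_wpDr.
      apply: sumr_ge0 => a _; rewrite mulr_ge0 ?(ltW (nu_gt0 a)) //.
      by apply: fsum_ge0 => h; exact: sqr_ge0.
    rewrite ler_pM2l ?nu_gt0 //.
    apply: (@fsum_term_le _ (fun h => iter (2 * k) lazy d u h ^+ 2)).
      exact: finsupp_sqr.
    by move=> h; exact: sqr_ge0.
  rewrite ler_pM2l ?nu_gt0 // mulnC exprM ler_sqr // nnegrE.
    have := bin_doob_le_lazy (k * 2) (k * 2) d0 u gone; rewrite binn mul1r.
    by apply: le_trans; exact: iter_doob_ge0.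
  by rewrite exprn_ge0 //; lra.
(* The [k]-step walk occurs in [2 * k] lazy steps with a coefficient of order 4^k up to 2k+1;
   against [(4 - eps) ^+ k] this is the origin of [1 - eps / 4]. *)
have := bin_doob_le_lazy (2 * k) k d0 u gone => /le_trans/(_ lazyb) h1.
move: big; rewrite returns_doob -/d; apply/negP; rewrite -leNgt exprMn mulrCA mulrC.
rewrite ler_pM2l ?exprn_gt0 //.
have -> : 1 - eps / 4 = (4 - eps) / 4 by field.
rewrite expr_div_n mulrA ler_pdivlMr ?exprn_gt0 //.
have cb : (4 ^+ k : R) <= (2 * k).+1%:R * 'C(2 * k, k)%:R.
  by rewrite -natrM -natrX ler_nat central_bin_lower.
have Dk0 : 0 <= iter k doob d u gone by exact: iter_doob_ge0.
apply: le_trans (ler_wpM2l Dk0 cb) _.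
by rewrite mulrCA ler_wpM2l // mulrC.
Qed.

End Doob.
End LazyWalk.

(** * From low energy to almost invariant means *)

Section AlmostInvariance.
Variables (V : finType) (E : rel V) (G : group) (lab : V -> G).
Implicit Types (f : V -> G -> R) (u v o a b : V) (g h : G) (w : seq V).
Hypothesis irr : label_irreducible E lab.

Lemma left_harnack chi pi (lam : R) w a : 0 <= lam -> (forall g, 0 < chi g) ->
  (forall g h, chi (gmul g h) = chi g * chi h) -> chi gone = 1 ->
  left_super E lab chi pi lam -> path E a w ->
  pi a * chi (path_label lab a w) <= lam ^+ size w * pi (last a w).
Proof.
move=> lam0 chi0 chiM chi1 [pi0 piS]; elim: w a => [|b w IH] a /=.
  by rewrite chi1 mulr1 expr0 mul1r.
move=> /andP[ab bw]; rewrite chiM mulrA.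
apply: (@le_trans _ _ (lam * pi b * chi (path_label lab b w))).
  rewrite ler_pM2r //; apply: le_trans (piS b); rewrite (bigD1 a) //= mulrC lerDl.
  by apply: sumr_ge0 => c _; rewrite mulr_ge0 // ltW.
by rewrite exprS -!mulrA ler_wpM2l // IH.
Qed.

(** The paths are chosen before [chi], [F], [pi] and [lam]. A path of label [gone] compares values
    without [chi]; one of label [ginv (lab a)] cancels the uncontrolled factor [chi (lab a)] in
    [cond]. Powers of [lam] are then bounded by powers of [L]. *)
Lemma uniform_harnack (L : R) : 1 <= L -> exists K : R, 0 < K /\
  forall chi F pi (lam : R), 1 <= lam -> lam <= L -> twist_super E lab chi F lam ->
  left_super E lab chi pi lam ->
  (forall a b, nu F pi a <= K * nu F pi b) /\
  (forall a b, nu F pi a <= K * cond lab chi F pi lam a b).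
Proof.
move=> L1; have L0 : 0 < L by exact: lt_le_trans L1.
have /choice[k kP] : forall p : V * V, exists k : R, 0 < k /\
    forall chi F pi (lam : R), 1 <= lam -> lam <= L -> twist_super E lab chi F lam ->
      left_super E lab chi pi lam -> nu F pi p.1 <= k * nu F pi p.2 /\
      nu F pi p.1 <= k * cond lab chi F pi lam p.1 p.2.
  move=> [a b] /=.
  have [w1 [_ ab1 l1 g1]] := irr a b gone.
  have [w2 [_ ba2 l2 g2]] := irr b a gone.
  have [w3 [_ ba3 l3 g3]] := irr b a (ginv (lab a)).
  exists (L ^+ (size w1 + size w2) + L ^+ (size w3).+1).
  have e1 : 0 < L ^+ (size w1 + size w2) by rewrite exprn_gt0.
  have e2 : 0 < L ^+ (size w3).+1 by rewrite exprn_gt0.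
  split=> [|chi F pi lam lam1 lamL tw lf]; first exact: addr_gt0.
  have lam0 : 0 < lam by exact: lt_le_trans lam1.
  have [chi0 chiM F0 _] := tw; have [pi0 _] := lf; have chi1 := twist_super_chi1 tw.
  have lamX n : lam ^+ n <= L ^+ n by rewrite lerXn2r // nnegrE ltW.
  have HF0 v h : 0 <= chi h * F v by rewrite mulr_ge0 // ltW.
  have hF := harnack (ltW lam0) HF0 (twist_super_transfer tw).
  have F2 := hF _ _ gone ba2; rewrite l2 g2 gmul1r chi1 !mul1r in F2.
  have F3 := hF _ _ (lab a) ba3; rewrite l3 g3 gmulVr chi1 !mul1r in F3.
  have P1 := left_harnack (ltW lam0) chi0 chiM chi1 lf ab1.
  rewrite l1 g1 chi1 mulr1 in P1.
  have nub : 0 < nu F pi b by rewrite mulr_gt0.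
  have cab : 0 < cond lab chi F pi lam a b.
    by rewrite /cond /nu /prob !mulr_gt0 // invr_gt0 mulr_gt0.
  split.
    apply: (@le_trans _ _ (L ^+ (size w1 + size w2) * nu F pi b)); last first.
      by rewrite ler_pM2r // lerDl ltW.
    apply: (@le_trans _ _ ((lam ^+ size w1 * pi b) * (lam ^+ size w2 * F b))).
      by apply: ler_pM => //; exact: ltW.
    by rewrite mulrACA -exprD ler_pM2r.
  apply: (@le_trans _ _ (L ^+ (size w3).+1 * cond lab chi F pi lam a b)); last first.
    by rewrite ler_pM2r // lerDr ltW.
  apply: (@le_trans _ _ (lam ^+ (size w3).+1 * cond lab chi F pi lam a b)); last first.
    by rewrite ler_pM2r.
  apply: (@le_trans _ _ (pi a * (lam ^+ size w3 * (chi (lab a) * F b)))).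
    by rewrite /nu ler_pM2l.
  rewrite exprS /cond /nu /prob le_eqVlt; apply/orP; left; apply/eqP.
  by have Fa := F0 a; field; rewrite !gt_eqF.
pose K := 1 + \sum_p k p.
have kK p : k p <= K.
  rewrite /K (bigD1 p) //= addrCA lerDl addr_ge0 // sumr_ge0 // => q _.
  by have [/ltW] := kP q.
exists K; split.
  by apply: ltr_wpDr => //; apply: sumr_ge0 => p _; have [/ltW] := kP p.
move=> chi F pi lam lam1 lamL tw lf.
have lam0 : 0 < lam by exact: lt_le_trans lam1.
split=> a b; have [_ /(_ chi F pi lam lam1 lamL tw lf) /= [n1 n2]] := kP (a, b).
  apply: le_trans n1 _; rewrite ler_pM2r ?kK //.
  by case: tw => _ _ F0 _; case: lf => pi0 _; rewrite mulr_gt0.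
by apply: le_trans n2 _; rewrite ler_pM2r ?kK // (cond_gt0 lam0 tw lf).
Qed.

(** Unfolds [(x - z)^2 <= 2 (x - y)^2 + 2 (y - z)^2] along a path: the tail is doubled, and the
    first edge costs [K ^+ 2], one [K] to move the weight from [o] to [u] and one from [u] to the
    edge. *)
Fixpoint path_cst (K : R) (n : nat) : R :=
  if n is n'.+1 then 2 * path_cst K n' + 2 * K ^+ 2 else 0.

Lemma path_cst_ge0 K n : 0 <= path_cst K n.
Proof. by elim: n => //= n IH; have := sqr_ge0 K; lra. Qed.

Section Bounds.
Variables (chi : G -> R) (F pi : V -> R) (lam K : R) (f : V -> G -> R) (o : V).
Hypotheses (lam0 : 0 < lam) (tw : twist_super E lab chi F lam)
  (lf : left_super E lab chi pi lam) (K0 : 0 < K).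
Hypothesis nuK : forall a b, nu F pi a <= K * nu F pi b.
Hypothesis condK : forall a b, nu F pi a <= K * cond lab chi F pi lam a b.
Hypothesis ff : forall a, finsupp (f a).
Let D := energy E lab chi F pi lam f.

Lemma path_energy w u : path E u w ->
  nu F pi o * fsum (fun h => (f (last u w) (gmul h (path_label lab u w)) - f u h) ^+ 2)
    <= path_cst K (size w) * D.
Proof.
have nu0 : 0 < nu F pi o := nu_gt0 tw lf o.
elim: w u => [|v w IH] u /=.
  move=> _; rewrite (@fsumE _ _ [::]) ?big_nil ?mulr0 ?mul0r // => h _.
  by rewrite gmul1r subrr expr0n.
move=> /andP[uv vw].
pose d1 h := (f (last v w) (gmul h (path_label lab v w)) - f v h) ^+ 2.
pose d2 h := (f v (gmul h (lab u)) - f u h) ^+ 2.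
have fd1 : finsupp d1 by exact: (finsupp_diff ff).
have fd2 : finsupp d2 by exact: (finsupp_diff ff).
have fd1s : finsupp (fun h => d1 (gmul h (lab u))) by exact: finsupp_shift.
apply: (@le_trans _ _ (nu F pi o * (2 * fsum d1 + 2 * fsum d2))).
  rewrite ler_pM2l // -(fsum_shift (lab u) d1) -!fsumZ // -fsumD; try exact: finsuppZ.
  apply: fsum_le; first exact: (finsupp_diff ff).
    by apply: finsuppD; exact: finsuppZ.
  move=> h; rewrite /d1 /d2 gmulA.
  set x := f (last v w) _; set y := f v _; set z := f u h.
  have -> : 2 * (x - y) ^+ 2 + 2 * (y - z) ^+ 2 = (x - z) ^+ 2 + (x - 2 * y + z) ^+ 2 by ring.
  by rewrite lerDl sqr_ge0.
have d20 : 0 <= fsum d2 by apply: fsum_ge0 => h; exact: sqr_ge0.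
have e2 : nu F pi o * fsum d2 <= K ^+ 2 * D.
  apply: (@le_trans _ _ (K ^+ 2 * (cond lab chi F pi lam u v * fsum d2))).
    rewrite mulrA ler_wpM2r // expr2 -mulrA; apply: le_trans (nuK o u) _.
    by rewrite ler_pM2l.
  rewrite ler_pM2l ?exprn_gt0 // /D /energy (bigD1 u) //= (bigD1 v) //= -/d2.
  rewrite -addrA lerDl addr_ge0 //.
    apply: sumr_ge0 => b _; rewrite mulr_ge0 ?(ltW (cond_gt0 lam0 tw lf _ _)) //.
    by apply: fsum_ge0 => h; exact: sqr_ge0.
  apply: sumr_ge0 => a _; apply: sumr_ge0 => b _.
  rewrite mulr_ge0 ?(ltW (cond_gt0 lam0 tw lf _ _)) //.
  by apply: fsum_ge0 => h; exact: sqr_ge0.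
have := IH v vw; rewrite -/d1; lra.
Qed.

Let S := fsum (fun h => f o h ^+ 2).

(** Paths of label [gone] compare the fibre over [a] with that over [o] without moving in [G]. So at
    small energy a fixed share of the norm sits over the single vertex [o], where [f o] is a
    function on [G]. *)
Lemma norm2_le_base (W : V -> seq V) :
  (forall a, [/\ path E o (W a), last o (W a) = a & path_label lab o (W a) = gone]) ->
  norm2 F pi f <= 2 * K * #|V|%:R * (nu F pi o * S) +
    2 * K * (\sum_a path_cst K (size (W a))) * D.
Proof.
move=> WP.
have -> : 2 * K * #|V|%:R * (nu F pi o * S) + 2 * K * (\sum_a path_cst K (size (W a))) * D =
    \sum_a (2 * K * (nu F pi o * S) + 2 * K * path_cst K (size (W a)) * D).
  by rewrite big_split /= sumr_const -mulr_suml -mulr_sumr -mulr_natr; ring.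
apply: ler_sum => a _; have [oa la ga] := WP a.
have := path_energy oa; rewrite la ga.
set d := fun h => _ => dD.
have fd : finsupp d by exact: (finsupp_diff ff).
have fo2 := finsupp_sqr (ff o).
have step : fsum (fun h => f a h ^+ 2) <= 2 * S + 2 * fsum d.
  rewrite /S -!fsumZ // -fsumD; try exact: finsuppZ.
  apply: fsum_le; [exact: finsupp_sqr | by apply: finsuppD; exact: finsuppZ | ].
  move=> h; rewrite /d gmul1r; set x := f a h; set y := f o h.
  have -> : 2 * y ^+ 2 + 2 * (x - y) ^+ 2 = x ^+ 2 + (2 * y - x) ^+ 2 by ring.
  by rewrite lerDl sqr_ge0.
have a0 : 0 <= fsum (fun h => f a h ^+ 2) by apply: fsum_ge0 => h; exact: sqr_ge0.
apply: (@le_trans _ _ (K * nu F pi o * fsum (fun h => f a h ^+ 2))).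
  by rewrite ler_wpM2r.
apply: (@le_trans _ _ (K * nu F pi o * (2 * S + 2 * fsum d))).
  by rewrite ler_pM2l // mulr_gt0 // (nu_gt0 tw lf).
have := ler_wpM2l (ltW K0) dD; lra.
Qed.

Lemma approx_mean_bound w g (t Q : R) phi C : 0 < t -> 0 < S ->
  path E o w -> last o w = o -> path_label lab o w = g ->
  D <= t ^+ 2 * norm2 F pi f -> norm2 F pi f <= Q * (nu F pi o * S) ->
  (forall x, `|phi x| <= C) ->
  `|fsum (fun h => f o h ^+ 2 * phi (gmul h g)) / S -
    fsum (fun h => f o h ^+ 2 * phi h) / S| <= C * (t * (Q * path_cst K (size w) + 2)).
Proof.
move=> t0 S0 ow lw gw DN NS phiC.
have nu0 : 0 < nu F pi o := nu_gt0 tw lf o.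
have := path_energy ow; rewrite lw gw.
pose d h := (f o (gmul h g) - f o h) ^+ 2; rewrite -/d => dD.
have fd : finsupp d by exact: (finsupp_diff ff).
have fo2 := finsupp_sqr (ff o).
have fog2 : finsupp (fun h => f o (gmul h g) ^+ 2).
  exact: (finsupp_shift g (f := fun h => f o h ^+ 2)).
have C0 : 0 <= C by apply: le_trans (phiC gone).
have dS : fsum d <= Q * path_cst K (size w) * t ^+ 2 * S.
  rewrite -(ler_pM2l nu0); apply: le_trans dD _.
  apply: (@le_trans _ _ (path_cst K (size w) * (t ^+ 2 * (Q * (nu F pi o * S))))).
    apply: ler_wpM2l; first exact: path_cst_ge0.
    by apply: le_trans DN _; rewrite ler_pM2l // exprn_gt0.
  by rewrite le_eqVlt; apply/orP; left; apply/eqP; ring.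
rewrite -mulrBl normrM [`|S^-1|]ger0_norm ?invr_ge0 ?(ltW S0) // ler_pdivrMr //.
rewrite -(fsum_shift g (fun h => f o h ^+ 2 * phi h)).
have fp1 : finsupp (fun h => f o h ^+ 2 * phi (gmul h g)).
  by apply: (finsupp_sub fo2) => h ->; rewrite mul0r.
have fp2 : finsupp (fun h => (-1) * (f o (gmul h g) ^+ 2 * phi (gmul h g))).
  by apply: (finsupp_sub fog2) => h ->; rewrite mul0r mulr0.
have -> : fsum (fun h => f o h ^+ 2 * phi (gmul h g)) -
    fsum (fun h => f o (gmul h g) ^+ 2 * phi (gmul h g)) =
    fsum (fun h => f o h ^+ 2 * phi (gmul h g) +
      (-1) * (f o (gmul h g) ^+ 2 * phi (gmul h g))).
  rewrite fsumD // fsumZ ?mulN1r //.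
  by apply: (finsupp_sub fog2) => h ->; rewrite mul0r.
(* A weighted arithmetic-geometric inequality for [x^2 - y^2] replaces Cauchy-Schwarz: since
   [fsum d] is of order [t ^+ 2], the weight [t] makes both terms of order [t]. *)
apply: (@le_trans _ _ (C * (t^-1 * fsum d + t * (S + fsum (fun h => f o (gmul h g) ^+ 2))))).
  rewrite /S -fsumD // -!fsumZ //; last exact: finsuppD.
  rewrite -fsumD; try (by apply: finsuppZ => //; exact: finsuppD).
  rewrite -fsumZ; last by apply: finsuppD; apply: finsuppZ => //; exact: finsuppD.
  apply: fsum_norm_le; first exact: finsuppD.
    apply: finsuppZ; apply: finsuppD; apply: finsuppZ => //; exact: finsuppD.
  move=> h; rewrite mulN1r -mulrBl normrM [leLHS]mulrC.
  apply: ler_pM => //; rewrite /d; set x := f o h; set y := f o _.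
  rewrite ler_norml; apply/andP; split; rewrite -subr_ge0.
    (* Completing the square in [y - x] leaves a positive quadratic form in [x] and [y]. *)
    have -> : x ^+ 2 - y ^+ 2 - - (t^-1 * (y - x) ^+ 2 + t * (x ^+ 2 + y ^+ 2)) =
       t^-1 * ((y - x - t / 2 * (x + y)) ^+ 2 + (t / 2) ^+ 2 * (3 * x ^+ 2 - 2 * x * y + 3 * y ^+ 2)).
      by field; rewrite gt_eqF.
    rewrite mulr_ge0 ?invr_ge0 ?(ltW t0) // addr_ge0 ?sqr_ge0 // mulr_ge0 ?sqr_ge0 //.
    have -> : 3 * x ^+ 2 - 2 * x * y + 3 * y ^+ 2 = 2 * x ^+ 2 + 2 * y ^+ 2 + (x - y) ^+ 2 by ring.
    by have := sqr_ge0 x; have := sqr_ge0 y; have := sqr_ge0 (x - y); lra.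
  have -> : t^-1 * (y - x) ^+ 2 + t * (x ^+ 2 + y ^+ 2) - (x ^+ 2 - y ^+ 2) =
     t^-1 * ((y - x + t / 2 * (x + y)) ^+ 2 + (t / 2) ^+ 2 * (3 * x ^+ 2 - 2 * x * y + 3 * y ^+ 2)).
    by field; rewrite gt_eqF.
  rewrite mulr_ge0 ?invr_ge0 ?(ltW t0) // addr_ge0 ?sqr_ge0 // mulr_ge0 ?sqr_ge0 //.
  have -> : 3 * x ^+ 2 - 2 * x * y + 3 * y ^+ 2 = 2 * x ^+ 2 + 2 * y ^+ 2 + (x - y) ^+ 2 by ring.
  by have := sqr_ge0 x; have := sqr_ge0 y; have := sqr_ge0 (x - y); lra.
rewrite (fsum_shift g (fun h => f o h ^+ 2)) -/S -mulrA ler_wpM2l //.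
apply: (@le_trans _ _ (t^-1 * (Q * path_cst K (size w) * t ^+ 2 * S) + t * (S + S))).
  by rewrite lerD2r ler_pM2l ?invr_gt0.
by rewrite le_eqVlt; apply/orP; left; apply/eqP; field; rewrite gt_eqF.
Qed.

Lemma density_mean : 0 < S ->
  is_mean (fun phi : G -> R => fsum (fun h => f o h ^+ 2 * phi h) / S).
Proof.
move=> S0; have fp phi : finsupp (fun h => f o h ^+ 2 * phi h).
  by apply: (finsupp_sub (finsupp_sqr (ff o))) => h ->; rewrite mul0r.
split=> [phi psi _ _|c phi _|phi _ phi0|].
- rewrite -mulrDl -fsumD //; congr (fsum _ / _).
  by apply/funext => h; rewrite mulrDr.
- rewrite mulrA -fsumZ //; congr (fsum _ / _).
  by apply/funext => h; rewrite mulrCA.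
- by rewrite divr_ge0 ?(ltW S0) // fsum_ge0 // => h; rewrite mulr_ge0 ?sqr_ge0.
- have -> : (fun h => f o h ^+ 2 * 1) = fun h => f o h ^+ 2.
    by apply/funext => h; rewrite mulr1.
  by rewrite divff // gt_eqF.
Qed.

End Bounds.
End AlmostInvariance.

(** [Hup] provides Doob transforms just above [rho] and [Hlow] keeps their returns large; the factor
    2k+1 is the one that [exists_low_energy] asks for. *)
Lemma amenable_of_growth (V : finType) (E : rel V) (G : group) (lab : V -> G)
    (o : V) (rho : R) : label_irreducible E lab -> 1 <= rho ->
  (forall lam : R, rho < lam -> exists chi F, twist_super E lab chi F lam) ->
  (forall lam : R, 0 < lam -> lam < rho -> exists k u,
     (2 * k).+1%:R * lam ^+ k < returns E lab k u) ->
  amenable G.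
Proof.
move=> irr rho1 Hup Hlow.
have rho0 : 0 < rho by exact: lt_le_trans rho1.
have [|K [K0 KP]] := uniform_harnack irr (L := 2 * rho); first lra.
have /choice[W WP] : forall a, exists w, [/\ path E o w, last o w = a &
    path_label lab o w = gone].
  by move=> a; have [w [_ ? ? ?]] := irr o a gone; exists w.
have /choice[Wg WgP] : forall g, exists w, [/\ path E o w, last o w = o &
    path_label lab o w = g].
  by move=> g; have [w [_ ? ? ?]] := irr o o g; exists w.
pose CA : R := \sum_a path_cst K (size (W a)).
have CA0 : 0 <= CA by apply: sumr_ge0 => a _; exact: path_cst_ge0.
pose Q : R := 4 * K * #|V|%:R.
pose B (g : G) : R := Q * path_cst K (size (Wg g)) + 2.
have small (t : R) : 0 < t -> (4 * K * CA + 1) * t <= 1 -> exists m, is_mean m /\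
    forall g phi C, (forall x, `|phi x| <= C) ->
      `|m (fun x => phi (gmul x g)) - m phi| <= C * (t * B g).
  move=> t0 tsmall.
  have KCA : 0 <= K * CA by rewrite mulr_ge0 // ltW.
  have t1 : t <= 1 by have := mulr_ge0 KCA (ltW t0); lra.
  have t2t : t ^+ 2 <= t by rewrite expr2 -[leRHS]mulr1 ler_pM2l.
  have t20 : 0 < t ^+ 2 by rewrite exprn_gt0.
  (* [th] is the factor [1 - eps / 4] of [exists_low_energy] for [eps = t ^+ 2]. With [s = 1 - th],
     the choice [lam = rho (1 + 3 s / 4)] keeps [lam * th] below [rho], so that [Hlow] applies
     there, and [mu = rho (1 + s / 2)] leaves the gap for [exists_left_super]. *)
  pose th : R := 1 - t ^+ 2 / 4.
  have th0 : 0 < th by rewrite /th; lra.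
  have th1 : th < 1 by rewrite /th; lra.
  pose mu : R := rho * (1 + (1 - th) / 2); pose lam : R := rho * (1 + (1 - th) * (3/4)).
  have rmu : rho < mu by rewrite /mu -[ltLHS]mulr1 ltr_pM2l //; lra.
  have mulam : mu < lam by rewrite /mu /lam ltr_pM2l //; lra.
  have lamL : lam <= 2 * rho by rewrite /lam [leRHS]mulrC ler_pM2l //; lra.
  have mu0 : 0 < mu by lra.
  have lam1 : 1 <= lam by lra.
  have lam0 : 0 < lam by lra.
  have lamth : lam * th < rho.
    rewrite /lam -mulrA -[ltRHS]mulr1 ltr_pM2l //; nra.
  have [chi [F twm]] := Hup mu rmu.
  have [pi lf] := exists_left_super o irr twm mu0 mulam.
  have tw : twist_super E lab chi F lam.
    case: twm => ? ? F0 FS; split=> // u; apply: le_trans (FS u) _.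
    by rewrite ler_pM2r // ltW.
  have [nuK condK] := KP chi F pi lam lam1 lamL tw lf.
  have [k [u ku]] := Hlow (lam * th) (mulr_gt0 lam0 th0) lamth.
  have [|f [ff low]] := exists_low_energy lam0 tw lf (ltW t20) _ ku; first lra.
  have DN := ltW low; set N := norm2 F pi f in low DN.
  set D := energy E lab chi F pi lam f in low DN.
  have D0 : 0 <= D := energy_ge0 lam0 tw lf f.
  have N0 : 0 < N by rewrite -(pmulr_rgt0 _ t20); exact: le_lt_trans low.
  have := norm2_le_base lam0 tw lf K0 nuK condK ff WP.
  rewrite -/CA -/D -/N => NS.
  have nu0 := nu_gt0 tw lf o.
  set S := fsum (fun h => f o h ^+ 2) in NS.
  have Dt : D <= t * N by apply: le_trans DN _; rewrite ler_pM2r.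
  (* The condition on [t] serves this: the energy term is absorbed by half of [N], which doubles the
     constant 2 of [norm2_le_base] to the 4 in [Q]. *)
  have half : 2 * K * CA * D <= N / 2.
    apply: (@le_trans _ _ (2 * K * CA * (t * N))).
      by rewrite ler_wpM2l // -mulrA mulr_ge0.
    have -> : 2 * K * CA * (t * N) = (2 * K * CA * t) * N by ring.
    by rewrite [leRHS]mulrC ler_pM2r //; lra.
  have NQ : N <= Q * (nu F pi o * S) by rewrite /Q; lra.
  have S0 : 0 < S.
    have QS : 0 < Q * (nu F pi o * S) by exact: lt_le_trans NQ.
    have S00 : 0 <= S by apply: fsum_ge0 => h; exact: sqr_ge0.
    rewrite lt_neqAle S00 andbT; apply/eqP => S_eq0.
    by move: QS; rewrite -S_eq0 !mulr0 ltxx.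
  exists (fun phi => fsum (fun h => f o h ^+ 2 * phi h) / S); split.
    exact: density_mean.
  move=> g phi C phiC; have [ow lw gw] := WgP g.
  exact: (approx_mean_bound lam0 tw lf K0 nuK condK ff t0 S0 ow lw gw DN NQ phiC).
pose T : R := 4 * K * CA + 1.
have T0 : 0 < T by rewrite /T; have := mulr_ge0 (ltW K0) CA0; lra.
have /choice[m mP] : forall n : nat, exists m, is_mean m /\
    forall g phi C, (forall x, `|phi x| <= C) ->
      `|m (fun x => phi (gmul x g)) - m phi| <= C * ((T * n.+1%:R)^-1 * B g).
  move=> n; apply: small; first by rewrite invr_gt0 mulr_gt0 // ltr0n.
  rewrite -/T invfM mulrA divff ?gt_eqF // mul1r invf_le1 ?ltr0n //.
  by rewrite ler1n.
apply: (@amenable_of_approx G m) => [n|g phi [C phiC] e e0]; first by case: (mP n).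
have [N Nlt] : exists N : nat, C * B g / T / e <= N%:R.
  by exists (Num.truncn `|C * B g / T / e|).+1; rewrite (le_trans (ler_norm _)) // ltW // truncnS_gt.
exists N => n Nn; have [_ /(_ g phi C phiC)] := mP n; move=> /le_trans; apply.
have -> : C * ((T * n.+1%:R)^-1 * B g) = C * B g / T / n.+1%:R.
  by rewrite invfM; ring.
rewrite ler_pdivrMr ?ltr0n // [leRHS]mulrC -ler_pdivrMr //; apply: le_trans Nlt _.
by rewrite ler_nat leqW.
Qed.

(** * Path counting *)

Fixpoint track (T : Type) (W : nat -> T) (n : nat) : seq T :=
  if n is n'.+1 then W 1%N :: track (fun i => W i.+1) n' else [::].

Lemma size_track (T : Type) (W : nat -> T) n : size (track W n) = n.
Proof. by elim: n W => //= n IH W; rewrite IH. Qed.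

Lemma last_track (T : Type) (W : nat -> T) n : last (W 0%N) (track W n) = W n.
Proof. by elim: n W => //= n IH W; rewrite (IH (fun i => W i.+1)). Qed.

Lemma nth_track (T : Type) (d : T) (W : nat -> T) n i : (i < n)%N ->
  nth d (track W n) i = W i.+1.
Proof. by elim: n W i => // n IH W [|i] //= lt; rewrite IH. Qed.

Lemma path_track (T : Type) (E : rel T) (W : nat -> T) n :
  (forall i, E (W i) (W i.+1)) -> path E (W 0%N) (track W n).
Proof.
by elim: n W => //= n IH W EW; rewrite EW (IH (fun i => W i.+1)).
Qed.

Lemma shiftn_shift (A : Type) i (x : nat -> A) : shiftn i (shift x) = shiftn i.+1 x.
Proof. by apply/funext => j; rewrite /shiftn /shift addSn. Qed.

Lemma In_map (S : eqType) (T : Type) (f : S -> T) (s : seq S) (x : T) :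
  List.In x (map f s) <-> exists2 y, y \in s & f y = x.
Proof.
elim: s => [|y s IH] /=; first by split=> [//|[]].
split=> [[<-|/IH[z zs <-]]|[z]].
- by exists y; rewrite ?inE ?eqxx.
- by exists z; rewrite ?inE ?zs ?orbT.
- rewrite inE => /orP[/eqP->|zs] e; [by left | by right; apply/IH; exists z].
Qed.

Lemma NoDup_map (S : eqType) (T : Type) (f : S -> T) (s : seq S) : uniq s ->
  {in s &, injective f} -> List.NoDup (map f s).
Proof.
elim: s => [|y s IH] /=; first by move=> _ _; constructor.
move=> /andP[ys us] inj; constructor; last first.
  by apply: IH => // a b sa sb; apply: inj; rewrite inE ?sa ?sb orbT.
move=> /In_map[z zs /inj zy]; move: ys.
by rewrite -zy ?zs // inE ?zs ?eqxx ?orbT.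
Qed.

Lemma card_of_eq (T : Type) (P : T -> Prop) n : is_card P n -> card_of P = n.
Proof.
move=> Pn.
have [l [ndl [lP <-]]] : is_card P (card_of P).
  by apply: ClassicalEpsilon.epsilon_spec; exists n.
have [l' [ndl' [lP' <-]]] := Pn.
apply/eqP; rewrite eqn_leq; apply/andP; split; apply/ssrnat.leP; apply: List.NoDup_incl_length => //.
  by move=> x /lP/lP'.
by move=> x /lP'/lP.
Qed.

Section Paths.
Variables (V : finType) (E : rel V) (G : group) (lab : V -> G).

Fixpoint paths (n : nat) (u : V) : seq (seq V) :=
  if n is n'.+1 then [seq v :: w | v <- enum (E u), w <- paths n' v] else [:: [::]].

Lemma mem_paths n u w : (w \in paths n u) = (size w == n) && path E u w.
Proof.
elim: n u w => [|n IH] u w; first by case: w.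
apply/allpairsPdep/idP => [[v [w' [uv vw ->]]]|].
  move: uv vw; rewrite mem_enum IH /= eqSS => uv /andP[-> ->].
  by rewrite andbT; exact: uv.
case: w => // v w /=; rewrite eqSS => /and3P[sw uv vw].
by exists v, w; rewrite mem_enum IH sw vw.
Qed.

Lemma uniq_paths n u : uniq (paths n u).
Proof.
elim: n u => //= n IH u; apply: allpairs_uniq_dep => [|v _|]; rewrite ?enum_uniq //.
by move=> [v w] [v' w'] _ _ /= [-> ->].
Qed.

Lemma iter_transferE n phi u g : iter n (transfer E lab) phi u g =
  \sum_(w <- paths n u) phi (last u w) (gmul g (path_label lab u w)).
Proof.
elim: n u g => [|n IH] u g; first by rewrite big_seq1 gmul1r.
rewrite /= big_allpairs_dep big_enum /=; apply: eq_bigr => v _.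
by rewrite IH; apply: eq_bigr => w _; rewrite gmulA.
Qed.

(** The start is recorded, so the rotations of a cycle count separately, as the points of a periodic
    orbit do. *)
Definition closed_paths n : seq (V * seq V) :=
  [seq (u, w) | u <- enum V,
     w <- [seq w <- paths n u | (last u w == u) && `[< path_label lab u w = gone >]]].

Lemma mem_closed_paths n u w : (u, w) \in closed_paths n <->
  [/\ size w = n, path E u w, last u w = u & path_label lab u w = gone].
Proof.
split=> [/allpairsPdep[u' [w' [_ + [-> ->]]]]|[sw uw lw gw]].
  rewrite mem_filter mem_paths => /andP[/andP[/eqP lw /asboolP gw] /andP[/eqP sw uw]].
  by [].
apply/allpairsPdep; exists u, w; rewrite mem_enum mem_filter mem_paths.
by rewrite lw eqxx sw eqxx uw asboolT.
Qed.

Lemma uniq_closed_paths n : uniq (closed_paths n).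
Proof.
apply: allpairs_uniq_dep => [|u _|]; rewrite ?enum_uniq ?filter_uniq ?uniq_paths //.
by move=> [v w] [v' w'] _ _ /= [-> ->].
Qed.

Lemma size_closed_paths n : (size (closed_paths n))%:R = \sum_u returns E lab n u.
Proof.
transitivity (\sum_(p <- closed_paths n) (1 : R)).
  by rewrite big_const_seq count_predT iter_addr_0.
rewrite big_allpairs_dep big_enum /=; apply: eq_bigr => u _.
rewrite /returns iter_transferE big_filter big_mkcond; apply: eq_bigr => w _.
by rewrite /dirac gmul1l; case: ifP.
Qed.

End Paths.

(** * Coding the subshift by a labelled graph *)

Section Coding.
Variables (A : finType) (M : rel A) (a0 : A) (k : nat).
Hypothesis serial : forall a, exists b, M a b.

(* Words have length at least 2, so that [M] is visible inside a word. *)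
Definition word := {t : k.+2.-tuple A | sorted M t}.

Definition letter (u : word) (i : nat) : A := nth a0 (val (val u)) i.

Definition overlap : rel word :=
  fun u v => [forall i : 'I_k.+1, letter u i.+1 == letter v i].

Definition prefix_of (x : nat -> A) (u : word) : Prop :=
  forall i, (i < k.+2)%N -> x i = letter u i.

Lemma letter_adj u i : (i < k.+1)%N -> M (letter u i) (letter u i.+1).
Proof.
move=> ik; have /(sortedP a0) := valP u; apply.
by rewrite size_tuple.
Qed.

Lemma overlapP u v : reflect (forall i, (i < k.+1)%N -> letter u i.+1 = letter v i)
  (overlap u v).
Proof.
apply: (iffP forallP) => H i; last exact/eqP/H.
by move=> ik; exact/eqP/(H (Ordinal ik)).
Qed.

Lemma prefix_of_inj x u v : prefix_of x u -> prefix_of x v -> u = v.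
Proof.
move=> xu xv; apply/val_inj/val_inj/(@eq_from_nth _ a0); rewrite !size_tuple // => i ik.
by rewrite -[LHS]xu ?xv.
Qed.

Lemma exists_prefix x : inSFT M x -> exists u, prefix_of x u.
Proof.
move=> Mx; have ss : size (mkseq x k.+2) == k.+2 by rewrite size_mkseq.
have so : sorted M (Tuple ss).
  apply/(sortedP a0) => i; rewrite size_mkseq => ik.
  by rewrite !nth_mkseq // ltnW.
by exists (exist _ (Tuple ss) so) => i ik; rewrite /letter /= nth_mkseq.
Qed.

Lemma exists_point u : exists x, inSFT M x /\ prefix_of x u.
Proof.
have /choice[sc scP] := serial.
(* After its last letter the word is continued by chosen successors; truncated subtraction makes the
   iteration empty before that. *)
exists (fun i => iter (i - k.+1) sc (letter u (minn i k.+1))); split=> i.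
  case: (ltnP i k.+1) => ik.
    have /eqP -> : (i - k.+1 == 0)%N by rewrite subn_eq0 ltnW.
    have /eqP -> : (i.+1 - k.+1 == 0)%N by rewrite subn_eq0.
    rewrite (minn_idPl ik); exact: letter_adj.
  rewrite subSn //.
  by rewrite (minn_idPr (leqW ik)) /=; exact: scP.
move=> ik; have /eqP -> : (i - k.+1 == 0)%N by rewrite subn_eq0.
by rewrite (minn_idPl _).
Qed.

Lemma prefix_overlap x u v : prefix_of x u -> prefix_of (shift x) v -> overlap u v.
Proof. by move=> xu xv; apply/overlapP => i ik; rewrite -xu // -xv // ltnW. Qed.

Lemma inSFT_shiftn x n : inSFT M x -> inSFT M (shiftn n x).
Proof. by move=> Mx i; rewrite /shiftn addnS. Qed.

Lemma exists_itinerary x : inSFT M x -> exists W : nat -> word,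
  (forall i, prefix_of (shiftn i x) (W i)) /\ forall i, overlap (W i) (W i.+1).
Proof.
move=> Mx.
have /choice[W WP] : forall i, exists u, prefix_of (shiftn i x) u.
  by move=> i; apply: exists_prefix; exact: inSFT_shiftn.
exists W; split=> // i; apply: (prefix_overlap (WP i)).
have -> : shift (shiftn i x) = shiftn i.+1 x; last exact: WP.
by apply/funext => j; rewrite /shiftn /shift addnS.
Qed.

Definition point (W : nat -> word) : nat -> A := fun i => letter (W i) 0.

Lemma point_prefix W : (forall i, overlap (W i) (W i.+1)) ->
  forall i, prefix_of (shiftn i (point W)) (W i).
Proof.
move=> EW i j; rewrite /shiftn /point.
elim: j i => [|j IH] i jk; first by rewrite addn0.
have /overlapP -> := EW i; last by [].
by rewrite -IH ?addSnnS // ltnW.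
Qed.

Lemma point_inSFT W : (forall i, overlap (W i) (W i.+1)) -> inSFT M (point W).
Proof.
move=> EW i; rewrite /point; have /overlapP <- // := EW i.
exact: letter_adj.
Qed.

Section Labels.
Variables (G : group) (psi : (nat -> A) -> G) (lab : word -> G).
Hypothesis labP : forall x u, inSFT M x -> prefix_of x u -> psi x = lab u.

(** A path of [n] edges reads the labels of its first [n] vertices and not that of its end: these
    are the [n] factors of the cocycle. *)
Lemma cocycle_label n x W : inSFT M x -> (forall i, prefix_of (shiftn i x) (W i)) ->
  cocycle psi n x = path_label lab (W 0%N) (track W n).
Proof.
elim: n x W => //= n IH x W Mx xW; congr (gmul _ _).
  by apply: labP => //; exact: (xW 0%N).
apply: (IH _ (fun i => W i.+1)) => [i|i]; first exact: Mx.
by rewrite shiftn_shift.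
Qed.

(** Transitivity is applied to the cylinders of [u] at [gone] and of [v] at [g]; the itinerary of
    the resulting orbit segment is the path, nonempty because [n] is positive. *)
Lemma label_irreducible_of_transitive : skew_transitive M psi ->
  label_irreducible overlap lab.
Proof.
move=> tr u v g.
pose cyl (u : word) (h : G) (p : (nat -> A) * G) := [/\ inSFT M p.1, prefix_of p.1 u & p.2 = h].
have cyl_open u' h : open_skew M (cyl u' h).
  split=> [p []//|p [Mp pu ph]]; exists k.+2 => y My yp.
  by split=> // i ik /=; rewrite yp // pu.
have cyl_ex u' h : exists p, cyl u' h p.
  by have [x [Mx xu]] := exists_point u'; exists (x, h).
have [n [n0 [[x h] [[/= Mx xu ->] [/= _ xv]]]]] :=
  tr _ _ (cyl_open v g) (cyl_open u gone) (cyl_ex v g) (cyl_ex u gone).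
rewrite gmul1l => xg; have [W [xW EW]] := exists_itinerary Mx.
have W0 : W 0%N = u by exact: prefix_of_inj (xW 0%N) xu.
have Wn : W n = v by exact: prefix_of_inj (xW n) xv.
exists (track W n); rewrite -W0 last_track path_track //.
by split=> //; [case: n n0 {xv xg Wn} | rewrite -(cocycle_label n Mx)].
Qed.

Definition cyclic_itinerary (n : nat) (p : word * seq word) : nat -> word :=
  fun i => nth p.1 (p.1 :: p.2) (i %% n).

Lemma cyclic_itineraryP n u w : (0 < n)%N -> (u, w) \in closed_paths overlap lab n ->
  (forall i, overlap (cyclic_itinerary n (u, w) i) (cyclic_itinerary n (u, w) i.+1)) /\
  track (cyclic_itinerary n (u, w)) n = w.
Proof.
move=> n0 /mem_closed_paths[sw uw lw gw].
have step i : (i < n)%N -> nth u w i = cyclic_itinerary n (u, w) i.+1.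
  move=> ltin; rewrite /cyclic_itinerary /=.
  have [ilt|ige] := ltnP i.+1 n; first by rewrite modn_small.
  have ein : i.+1 = n by apply/eqP; rewrite eqn_leq ltin ige.
  by rewrite ein modnn /= -{2}lw (last_nth u) sw -ein.
split=> [i|].
  have lt : (i %% n < n)%N by rewrite ltn_mod.
  have -> : cyclic_itinerary n (u, w) i.+1 = cyclic_itinerary n (u, w) (i %% n).+1.
    by rewrite /cyclic_itinerary -(addn1 i) -modnDml addn1.
  rewrite -step // {1}/cyclic_itinerary /=.
  by have /(pathP u) := uw; apply; rewrite sw.
apply: (@eq_from_nth _ u); rewrite size_track ?sw // => i ltin.
by rewrite nth_track // step.
Qed.

(** Itineraries match the periodic points of trivial cocycle with the closed paths of trivial label.
    At [n = 0] every point of the subshift qualifies and [card_of] may be arbitrary, hence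
    [0 < n]. *)
Lemma nperE n : (0 < n)%N -> (nper M psi n)%:R = \sum_u returns overlap lab n u.
Proof.
move=> n0; rewrite -size_closed_paths; congr (_%:R).
pose pt p := point (cyclic_itinerary n p).
apply: card_of_eq; exists (map pt (closed_paths overlap lab n)); split; last split.
- apply: NoDup_map; first exact: uniq_closed_paths.
  move=> [u w] [u' w'] cl cl' eq_pt.
  have [EW tW] := cyclic_itineraryP n0 cl; have [EW' tW'] := cyclic_itineraryP n0 cl'.
  have eqW : cyclic_itinerary n (u, w) = cyclic_itinerary n (u', w').
    apply/funext => i; apply: (@prefix_of_inj (shiftn i (pt (u, w)))).
      exact: point_prefix.
    by rewrite eq_pt; exact: point_prefix.
  rewrite -tW -tW' eqW; congr (_, _).
  by move/(congr1 (fun W => W 0%N)): eqW; rewrite /cyclic_itinerary mod0n.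
- move=> x; split=> [/In_map[[u w] cl <-]|[Mx [px cx]]].
    have [EW tW] := cyclic_itineraryP n0 cl.
    have Mp : inSFT M (pt (u, w)) by exact: point_inSFT.
    split=> //; split.
      by apply/funext => i; rewrite /pt /shiftn /point /cyclic_itinerary modnDl.
    rewrite (cocycle_label n Mp (point_prefix EW)) tW.
    have [_ _ _ <-] : [/\ size w = n, path overlap u w, last u w = u &
      path_label lab u w = gone] by apply/mem_closed_paths.
    by rewrite /cyclic_itinerary mod0n.
  have [W [xW EW]] := exists_itinerary Mx.
  have Wper i : W (n + i)%N = W i.
    apply: (@prefix_of_inj (shiftn i x)) => //.
    suff <- : shiftn (n + i) x = shiftn i x by exact: xW.
    by rewrite -{2}px; apply/funext => j; rewrite /shiftn addnA.
  have Wmod i : W (i %% n)%N = W i.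
    rewrite {2}(divn_eq i n); elim: (i %/ n)%N => [|q IH]; first by rewrite mul0n.
    by rewrite mulSn -addnA Wper.
  apply/In_map; exists (W 0%N, track W n).
    apply/mem_closed_paths; rewrite size_track last_track path_track //; split=> //.
      by rewrite -(Wper 0%N) addn0.
    by rewrite -(cocycle_label n Mx).
  apply/funext => i; rewrite /pt /point /cyclic_itinerary.
  have lt : (i %% n < n)%N by rewrite ltn_mod.
  have -> : nth (W 0%N) (W 0%N :: track W n) (i %% n) = W i.
    rewrite -(Wmod i); case: (i %% n)%N lt => //= j jn.
    by rewrite nth_track // ltnW.
  by rewrite -(xW i) // /shiftn addn0.
- by rewrite -[RHS](size_map pt); elim: (map _ _) => //= a l ->.
Qed.

End Labels.

Lemma exists_label (G : group) (psi : (nat -> A) -> G) :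
  (forall x y, inSFT M x -> inSFT M y -> (forall i, (i < k)%N -> x i = y i) ->
    psi x = psi y) ->
  exists lab : word -> G, forall x u, inSFT M x -> prefix_of x u -> psi x = lab u.
Proof.
move=> loc; have /choice[pt ptP] := exists_point.
exists (fun u => psi (pt u)) => x u Mx xu; have [Mp pu] := ptP u.
by apply: loc => // i ik; rewrite xu ?pu // (leq_trans ik) // -addn2 leq_addr.
Qed.

End Coding.

(** * Exponential growth rates *)

Definition growth (N : nat -> nat) : \bar R := limn_esup (fun n : nat =>
  if N n == 0%N then -oo%E else (ln (N n)%:R / n%:R)%:E).

Lemma h_GurE (A : finType) (M : rel A) (G : group) (psi : (nat -> A) -> G) :
  h_Gur M psi = growth (nper M psi).
Proof. by []. Qed.

Lemma growth_lt (N : nat -> nat) (c : R) : (growth N < c%:E)%E ->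
  exists n0, forall n, (n0 <= n)%N -> (N n)%:R <= expR c ^+ n.
Proof.
move=> /ereal_inf_lt[_ [S [n1 _ n1S] <-]] supc.
exists n1.+1 => n lt1n.
have n0 : 0 < n%:R :> R by rewrite ltr0n; exact: leq_ltn_trans lt1n.
have : ((if N n == 0%N then -oo else (ln (N n)%:R / n%:R)%:E) <= c%:E)%E.
  apply: le_trans (ltW supc); apply: ereal_sup_ubound; exists n => //.
  by apply: n1S => /=; exact: ltnW.
case: eqP => [-> _|/eqP Nn0]; first by rewrite exprn_ge0 // expR_ge0.
have N0 : 0 < (N n)%:R :> R by rewrite ltr0n lt0n.
rewrite lee_fin ler_pdivrMr // -ler_expR lnK ?posrE // => /le_trans; apply.
by rewrite mulrC expRM_natl.
Qed.

Lemma growth_le (N : nat -> nat) (C mu : R) : 0 < C -> 0 < mu ->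
  (forall n, (0 < n)%N -> (N n)%:R <= C * (2 * n).+1%:R * mu ^+ n) ->
  (growth N <= (ln mu)%:E)%E.
Proof.
move=> C0 mu0 NC; apply/lee_addgt0Pr => e e0.
(* Since [expR (e n) >= (e n / 2)^2] and [C (2 n + 1) <= 3 C n], it suffices that
   [e^2 n / 4 >= 3 C]. *)
have [n1 n1P] : exists n1 : nat, 12 * C / e ^+ 2 <= n1%:R.
  by exists (Num.truncn (12 * C / e ^+ 2)).+1; rewrite ltW // truncnS_gt.
apply: (@le_trans _ _ (ereal_sup ((fun n : nat =>
  if N n == 0%N then -oo%E else (ln (N n)%:R / n%:R)%:E) @` [set n | (n1 < n)%N]))).
  by apply: ereal_inf_lbound; exists [set n | (n1 < n)%N] => //; exists n1.+1.
apply: ge_ereal_sup => _ [n /= lt1n <-]; case: eqP => [_|/eqP Nn0]; first exact: leNye.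
have ngt0 : (0 < n)%N by exact: leq_ltn_trans lt1n.
have n0 : 0 < n%:R :> R by rewrite ltr0n.
have n1' : 1 <= n%:R :> R by rewrite ler1n.
have N0 : 0 < (N n)%:R :> R by rewrite ltr0n lt0n.
rewrite -EFinD lee_fin ler_pdivrMr // -ler_expR lnK ?posrE //.
apply: le_trans (NC n ngt0) _.
rewrite mulrDl exp.expRD -mulrC [ln mu * _]mulrC expRM_natl lnK ?posrE //.
rewrite [leRHS]mulrC [leRHS]mulrC ler_pM2l ?exprn_gt0 //.
have e20 : 0 < e ^+ 2 by rewrite exprn_gt0.
have en : 12 * C <= e ^+ 2 * n%:R.
  rewrite [leRHS]mulrC -ler_pdivrMr //; apply: le_trans n1P _.
  by rewrite ler_nat ltnW.
have half : 1 + e * n%:R / 2 <= expR (e * n%:R / 2) by exact: expR_ge1Dx.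
have -> : expR (e * n%:R) = expR (e * n%:R / 2) ^+ 2.
  by rewrite expr2 -exp.expRD -splitr.
apply: (@le_trans _ _ ((e * n%:R / 2) ^+ 2)); last first.
  have e2 : 0 <= e * n%:R / 2 by rewrite divr_ge0 // mulr_ge0 // ltW.
  by rewrite lerXn2r ?nnegrE ?expR_ge0 //; apply: le_trans half; rewrite lerDr.
rewrite -natr1 natrM.
have -> : (e * n%:R / 2) ^+ 2 = (e ^+ 2 * n%:R) * n%:R / 4 by field.
have := ler_wpM2r (ltW n0) en.
have := ler_wpM2l (ltW C0) n1'; lra.
Qed.

Lemma growth_mono (N N' : nat -> nat) : (forall n, (0 < n)%N -> (N n <= N' n)%N) ->
  (growth N <= growth N')%E.
Proof.
move=> NN'; apply: le_ereal_inf_tmp => _ [S [n1 _ n1S] <-].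
apply: (@le_trans _ _ (ereal_sup ((fun n : nat =>
  if N n == 0%N then -oo%E else (ln (N n)%:R / n%:R)%:E) @` [set n | (n1 < n)%N]))).
  by apply: ereal_inf_lbound; exists [set n | (n1 < n)%N] => //; exists n1.+1.
apply: ge_ereal_sup => _ [n /= lt1n <-].
have ngt0 : (0 < n)%N by exact: leq_ltn_trans lt1n.
apply: (@le_trans _ _ (if N' n == 0%N then -oo else (ln (N' n)%:R / n%:R)%:E)%E).
  have le := NN' _ ngt0; case: eqP => [_|/eqP]; first exact: leNye.
  rewrite -lt0n => N0; have N'0 := leq_trans N0 le.
  rewrite gtn_eqF // lee_fin ler_pM2r ?invr_gt0 ?ltr0n //.
  by rewrite ler_ln ?posrE ?ltr0n // ler_nat.
by apply: ereal_sup_ubound; exists n => //; apply: n1S; exact: ltnW.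
Qed.

(** Nonzero counts at arbitrarily large times rule out the default [-oo], and each has a nonnegative
    logarithm. *)
Lemma growth_ge0 (N : nat -> nat) :
  (forall n0, exists n, (n0 <= n)%N /\ (0 < N n)%N) -> (0 <= growth N)%E.
Proof.
move=> Ninf; apply: le_ereal_inf_tmp => _ [S [n1 _ n1S] <-].
have [n [n1n N0]] := Ninf n1.
apply: (@le_trans _ _ (ln (N n)%:R / n%:R)%:E).
  by rewrite lee_fin divr_ge0 // ln_ge0 // ler1n.
by apply: ereal_sup_ubound; exists n; [exact: n1S | rewrite gtn_eqF].
Qed.

(** * Abelianization and characters *)

Lemma group_hom_one (G H : group) (f : G -> H) : group_hom f -> f gone = gone.
Proof.
move=> fM; apply: (@gmul_injr _ (f gone)).
by rewrite /= -fM !gmul1l.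
Qed.

Section Abelianization.
Variables (G Gab : group) (pi : G -> Gab).
Hypothesis piab : is_abelianization pi.

Let piM : group_hom pi. Proof. by case: piab. Qed.
Let pi_surj h : exists g, pi g = h. Proof. by case: piab. Qed.
Let pi_ker g : pi g = gone <-> in_commutator_subgroup g.
Proof. by case: piab. Qed.

Lemma abelianization_comm (x y : Gab) : gmul x y = gmul y x.
Proof.
have [a <-] := pi_surj x; have [b <-] := pi_surj y; rewrite -!piM.
have : pi (commutator a b) = gone.
  by apply/pi_ker; exists [:: (a, b)]; rewrite /= gmul1r.
move=> /(congr1 (gmul (pi (gmul b a)))); rewrite gmul1r -piM => <-; congr pi.
by rewrite /commutator !gmulA -(gmulA b) gmulVr gmul1r gmulVr gmul1l.
Qed.

Lemma abelianization_amenable : countable_group G -> amenable Gab.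
Proof.
move=> [code code_inj]; apply: abelian_amenable abelianization_comm.
have /choice[s sP] := pi_surj; exists (fun h => code (s h)) => x y /code_inj e.
by rewrite -(sP x) -(sP y) e.
Qed.

Lemma path_label_hom (V : finType) (lab : V -> G) (u : V) (w : seq V) :
  path_label (fun v => pi (lab v)) u w = pi (path_label lab u w).
Proof.
elim: w u => [|v w IH] u /=; first by rewrite (group_hom_one piM).
by rewrite IH piM.
Qed.

Lemma label_irreducible_hom (V : finType) (E : rel V) (lab : V -> G) :
  label_irreducible E lab -> label_irreducible E (fun v => pi (lab v)).
Proof.
move=> irr u v h; have [g <-] := pi_surj h; have [w [? ? ? <-]] := irr u v g.
by exists w; rewrite path_label_hom.
Qed.

Lemma returns_hom_le (V : finType) (E : rel V) (lab : V -> G) n u :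
  returns E lab n u <= returns E (fun v => pi (lab v)) n u.
Proof.
rewrite /returns !iter_transferE; apply: ler_sum => w _.
rewrite /dirac !gmul1l path_label_hom ler_nat.
case: eqP => //= _; case: asboolP => // ->.
by rewrite (group_hom_one piM) asboolT.
Qed.

Lemma hom_commutator1 (chi : G -> R) : (forall g, 0 < chi g) ->
  (forall g h, chi (gmul g h) = chi g * chi h) -> chi gone = 1 ->
  forall g, in_commutator_subgroup g -> chi g = 1.
Proof.
move=> chi0 chiM chi1 g [l ->]; elim: l => //= [[a b] l IH].
have chiV c : chi (ginv c) = (chi c)^-1.
  have c0 : chi c != 0 by rewrite gt_eqF.
  by apply: (mulfI c0); rewrite -chiM gmulVr divff.
rewrite chiM IH mulr1 /commutator !chiM !chiV /=.
by have := chi0 a; have := chi0 b => hb ha; field; rewrite !gt_eqF.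
Qed.

(** A character into the commutative group of positive reals kills commutators, hence factors
    through [pi]. This is why the abelianization is the quotient to compare with. *)
Lemma twist_super_descend (V : finType) (E : rel V) (lab : V -> G) chi F lam :
  twist_super E lab chi F lam ->
  exists chi', twist_super E (fun v => pi (lab v)) chi' F lam.
Proof.
move=> tw; have [chi0 chiM F0 FS] := tw; have chi1 := twist_super_chi1 tw.
have /choice[s sP] := pi_surj.
have chi_eq g g' : pi g = pi g' -> chi g = chi g'.
  move=> e; have : pi (gmul g (ginv g')) = gone.
    by rewrite piM e -piM gmulVr (group_hom_one piM).
  move=> /pi_ker/(hom_commutator1 chi0 chiM chi1) e1.
  by rewrite -[chi g']mul1r -e1 -chiM -gmulA gmulVl gmul1r.
exists (fun h => chi (s h)); split=> // [g h|u].
  by rewrite -chiM; apply: chi_eq; rewrite piM !sP.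
by rewrite (chi_eq _ (lab u)) ?sP.
Qed.

Lemma twist_super_lift (V : finType) (E : rel V) (lab : V -> G) chi F lam :
  twist_super E (fun v => pi (lab v)) chi F lam ->
  twist_super E lab (fun g => chi (pi g)) F lam.
Proof. by case=> chi0 chiM F0 FS; split=> // g h; rewrite piM chiM. Qed.

End Abelianization.

(** * Growth rates and return weights *)

Lemma returns_ge0 (V : finType) (E : rel V) (G : group) (lab : V -> G) n u :
  0 <= returns E lab n u.
Proof. by apply: iter_transfer_ge0; exact: dirac_ge0. Qed.

Lemma growth_lt_returns (V : finType) (E : rel V) (G : group) (lab : V -> G)
    (N : nat -> nat) (c : R) (o : V) :
  (forall n, (0 < n)%N -> (N n)%:R = \sum_u returns E lab n u) ->
  (growth N < c%:E)%E -> exists C, forall n, returns E lab n o <= C * expR c ^+ n.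
Proof.
move=> NE /growth_lt[n0 n0P].
(* The growth bound holds from [n0] on; the finitely many earlier terms go into the constant. *)
pose S := \sum_(i < n0.+1) returns E lab i o / expR c ^+ i.
have ec n : 0 < expR c ^+ n by rewrite exprn_gt0 // expR_gt0.
have t0 i : 0 <= returns E lab i o / expR c ^+ i.
  by rewrite divr_ge0 ?returns_ge0 // ltW.
exists (1 + S) => n; have S0 : 0 <= S by apply: sumr_ge0.
have [lt|ge] := ltnP n n0.+1.
  rewrite -ler_pdivrMr // /S (bigD1 (Ordinal lt)) //= addrCA lerDl.
  by rewrite addr_ge0 // sumr_ge0.
apply: (@le_trans _ _ (expR c ^+ n)); last by rewrite ler_peMl ?(ltW (ec n)) // lerDl.
apply: le_trans (n0P n (ltnW ge)); rewrite NE ?(leq_ltn_trans _ ge) //.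
by rewrite (bigD1 o) //= lerDl; apply: sumr_ge0 => u _; exact: returns_ge0.
Qed.

Lemma growth_le_twist (V : finType) (E : rel V) (G : group) (lab : V -> G)
    (N : nat -> nat) chi F (lam : R) :
  (forall n, (0 < n)%N -> (N n)%:R = \sum_u returns E lab n u) -> 0 < lam ->
  twist_super E lab chi F lam -> (growth N <= (ln lam)%:E)%E.
Proof.
move=> NE lam0 tw; apply: (@growth_le _ (1 + #|V|%:R)) => // n n0.
rewrite NE //; apply: (@le_trans _ _ (\sum_(u : V) lam ^+ n)).
  by apply: ler_sum => u _; exact: returns_twist_super (ltW lam0) tw.
rewrite sumr_const -[leLHS]mulr_natl ler_pM2r ?exprn_gt0 // -[leLHS]mulr1.
by apply: ler_pM => //; rewrite ?lerDr ?ler1n.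
Qed.

Lemma growth_returns_ge0 (V : finType) (E : rel V) (G : group) (lab : V -> G)
    (N : nat -> nat) (o : V) :
  (forall n, (0 < n)%N -> (N n)%:R = \sum_u returns E lab n u) ->
  label_irreducible E lab -> (0 <= growth N)%E.
Proof.
move=> NE irr; have [w [w0 ow lw gw]] := irr o o gone.
have ret j : 1 <= returns E lab (j * size w) o.
  elim: j => [|j IH]; first by rewrite mul0n /returns /= dirac_diag.
  apply: le_trans IH _; rewrite mulSn /returns iterD.
  have := path_le_iter lab (iter_transfer_ge0 E lab (j * size w)%N (dirac_ge0 o gone)) gone ow.
  by rewrite lw gw gmul1l.
have sw : (0 < size w)%N by case: (w) w0.
apply: growth_ge0 => n0; exists (n0.+1 * size w)%N; split.
  by rewrite (leq_trans (leqnSn _)) // leq_pmulr.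
rewrite -(ltr0n R) NE ?muln_gt0 //; apply: lt_le_trans ltr01 _.
apply: le_trans (ret n0.+1) _; rewrite (bigD1 o) //= lerDl.
by apply: sumr_ge0 => u _; exact: returns_ge0.
Qed.

Theorem theorem1p3 (A : finType) (M : rel A) (G : group)
    (psi : (nat -> A) -> G) (Gab : group) (pi : G -> Gab) :
  (0 < #|A|)%N -> mixing_rel M -> countable_group G ->
  locally_constant M psi ->
  is_abelianization pi ->
  skew_transitive M psi ->
  (h_Gur M psi = h_Gur M (fun x => pi (psi x)) <-> amenable G).
Proof.
move=> /card_gt0P[a0 _] mix cG [k loc] piab tr; rewrite !h_GurE.
have serial a : exists b, M a b.
  (* Time [N.+1] rather than [N]: a walk of positive length has a first step. *)
  have [N NP] := mix; have [w [w0 _ wM]] := NP N.+1 (leqnSn N) a a.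
  by exists (w 1%N); rewrite -w0 wM.
have [lab labP] := exists_label a0 serial loc.
pose V : finType := word M k; pose E : rel V := @overlap A M a0 k.
pose labab v := pi (lab v).
have lababP x u : inSFT M x -> prefix_of a0 x u -> pi (psi x) = labab u.
  by move=> Mx xu; rewrite (labP x u).
have irr : label_irreducible E lab := label_irreducible_of_transitive serial labP tr.
have irrab : label_irreducible E labab := label_irreducible_hom piab irr.
have NE n (n0 : (0 < n)%N) : (nper M psi n)%:R = \sum_u returns E lab n u := nperE labP n0.
have NEab n (n0 : (0 < n)%N) :
    (nper M (fun x => pi (psi x)) n)%:R = \sum_u returns E labab n u := nperE lababP n0.
have [o _] : exists o : V, True.
  have /choice[sc scP] := serial.
  have Mx : inSFT M (fun i => iter i sc a0) by move=> i; exact: scP.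
  by have [u _] := exists_prefix a0 k Mx; exists u.
have h0 := growth_returns_ge0 o NE irr.
have mono : (growth (nper M psi) <= growth (nper M (fun x => pi (psi x))))%E.
  apply: growth_mono => n n0; rewrite -(ler_nat R) NE // NEab //.
  by apply: ler_sum => u _; exact: returns_hom_le.
(* Constant [chi] and [F] with the out-degree bound [#|V|] exclude [+oo]. As [h0] excludes [-oo],
   the entropy is a real [r >= 0], which gives [1 <= expR r] below. *)
have hfin : (growth (nper M psi) < +oo)%E.
  apply: le_lt_trans (ltry (ln #|V|%:R)).
  apply: (growth_le_twist NE (chi := fun=> 1) (F := fun=> 1)).
    by rewrite ltr0n; apply/card_gt0P; exists o.
  split=> // [g h|u]; first by rewrite mulr1.
  by rewrite !mulr1 sumr_const ler_nat max_card.
case e : (growth (nper M psi)) h0 hfin mono => [r||] // h0 _ mono.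
have mid (x y : R) : x < y -> exists2 z, x < z & z < y.
  by move=> xy; exists ((x + y) / 2); rewrite ?midf_lt.
split=> [eqh|am].
  apply: (@amenable_of_growth V E G lab o (expR r)) => //.
  - by rewrite -exp.expR0 ler_expR.
  - move=> lam rlam; have lam0 : 0 < lam by exact: lt_trans (expR_gt0 r) rlam.
    have [c rc clam] : exists2 c, r < c & c < ln lam.
      by apply: mid; rewrite -ltr_expR lnK.
    (* Equality of the entropies enters here: [r] is also the rate of the [Gab]-cover. *)
    have hc : (growth (nper M (fun x => pi (psi x))) < c%:E)%E by rewrite -eqh lte_fin.
    have [C CP] := growth_lt_returns o NEab hc.
    have elam : expR c < lam by rewrite -[ltRHS]lnK // ltr_expR.
    have [chi [F tw]] := amenable_twist_super
      (abelianization_amenable piab cG) irrab (expR_gt0 c) elam CP.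
    by exists (fun g => chi (pi g)), F; exact: (twist_super_lift piab).
  (* Otherwise all return weights are at most [(2 * k).+1%:R * lam ^+ k], and the growth could not
     exceed [ln lam], which is below [r]. *)
  - move=> lam lam0 lamr; apply: contrapT => nex.
    have : (growth (nper M psi) <= (ln lam)%:E)%E.
      apply: (@growth_le _ (1 + #|V|%:R)) => // n n0.
      rewrite NE //; apply: (@le_trans _ _ (\sum_(u : V) (2 * n).+1%:R * lam ^+ n)).
        apply: ler_sum => u _; rewrite leNgt; apply/negP => lt; apply: nex.
        by exists n, u.
      rewrite sumr_const -[leLHS]mulr_natl mulrA ler_pM2r ?exprn_gt0 //.
      by rewrite ler_pM2r ?ltr0n // lerDr.
    by rewrite e lee_fin -ler_expR lnK // leNgt lamr.
(* It remains to bound the [Gab]-growth by [r + d]; the intermediate rate [r + d / 2] provides the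
   strict gap for [amenable_twist_super]. *)
apply/eqP; rewrite eq_le mono /=; apply/lee_addgt0Pr => d d0.
rewrite -EFinD -(expRK (r + d)).
have rd2 : r + d / 2 < r + d by rewrite ltrD2l; lra.
have hd : (growth (nper M psi) < (r + d / 2)%:E)%E.
  by rewrite e lte_fin ltrDl divr_gt0.
have [C CP] := growth_lt_returns o NE hd.
have erd : expR (r + d / 2) < expR (r + d) by rewrite ltr_expR.
have [chi [F tw]] := amenable_twist_super am irr (expR_gt0 _) erd CP.
have [chi' tw'] := twist_super_descend piab tw.
exact: growth_le_twist NEab (expR_gt0 _) tw'.
Qed.
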